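(* Suppose that $\mathcal F=\{f_1,\dots,f_n\}$ is finite and that $\sum_{i=1}^n|f_i|^2>0$ on $\Omega_0$. Then there exists at least one worst-case optimal multiplier, i.e. a minimizer over $L^2(\Omega_0)$ of $E_S(m)=\sup_{v\in S}E(v,m)$. Furthermore, for any worst-case optimal multiplier $m^\star$ there exists a positive semidefinite Hermitian matrix $\Sigma\in\mathbb{C}^{n\times n}$ such that $$m^\star=\frac{(\mathbf f,\Sigma D_\alpha\mathbf f)}{(\mathbf f,\Sigma\mathbf f)}.$$
   Context: Let $d\ge 1$, let $u_1,\dots,u_n\in L^2(\mathbb{R}^d)$ be linearly independent complex-valued functions supported in the unit cube of $\mathbb{R}^d$, and let $f_1,\dots,f_n$ be their Fourier transforms (real-analytic on $\mathbb{R}^d$), $\mathcal F=\{f_1,\dots,f_n\}$. Let $\Omega_0\subset\mathbb{R}^d$ be compact with non-empty interior, $\alpha>1$, and $D_\alpha v(\xi)=v(\alpha\xi)$. Put $\mathbf f=(f_1,\dots,f_n)^{T}$ and $D_\alpha\mathbf f=(D_\alpha f_1,\dots,D_\alpha f_n)^{T}$, functions $\mathbb{R}^d\to\mathbb{C}^n$, and $(\mathbf x,\mathbf y)=\sum_{k=1}^n x_k^*y_k$ for $\mathbf x,\mathbf y\in\mathbb{C}^n$ ($^*$ denotes complex conjugation); the quotient is taken pointwise (almost everywhere on $\Omega_0$). Let $V=\operatorname{span}(\mathcal F)$ (complex linear combinations), with norm $\|\sum_ic_if_i\|_V=(\sum_i|c_i|^2)^{1/2}$. Let $\mu$ be a measure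 on $\mathbb{R}^d$ for which there exist constants $c_\mu,C_\mu>0$ with $c_\mu\|v\|_{L^2}^2\le\int|v(\xi)|^2\,d\mu(\xi)\le C_\mu\|v\|_{L^2}^2$ for all $v\in V$. For $v\in V$ and $m\in L^2(\Omega_0)$ let $E(v,m)=\frac12\int_{\Omega_0}|D_\alpha v(\xi)-m(\xi)v(\xi)|^2\,d\mu(\xi)$. Let $S$ be a compact subset of $V$.
   Formalization: Existence assumes the functions in S have no common zero on Ω0; the formula assumes S contains a nonzero function. L²(Ω0) is taken with respect to μ. The denominator is nonzero Lebesgue-a.e. on Ω0, and the formula holds μ-a.e. where it is nonzero. *)

(* Defs.v *)
From HB Require Import structures.
From mathcomp Require Import all_boot all_order all_algebra.
From mathcomp Require Import all_classical all_reals all_analysis.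
From mathcomp Require Import measurable_realfun complex.
Set Implicit Arguments.
Unset Strict Implicit.
Unset Printing Implicit Defensive.
Import Order.TTheory GRing.Theory Num.Theory.
Import numFieldNormedType.Exports.
Local Open Scope classical_set_scope.
Local Open Scope ring_scope.

(* 'rV[R]_d plays the role of R^d and carries its Borel sigma-algebra. *)
HB.instance Definition _ (R : realType) (d : nat) :=
  @isMeasurable.Build (sigma_display (@open 'rV[R]_d)) 'rV[R]_d
    <<s (@open 'rV[R]_d) >> (@sigma_algebra0 _ setT _) (@sigma_algebraC _ _)
    (@sigma_algebra_bigcup _ setT _).

Section rV_borel.
Context (R : realType) (d : nat).

Lemma open_measurable_rV (A : set 'rV[R]_d) : open A -> measurable A.
Proof. exact: sub_sigma_algebra. Qed.

Lemma measurable_coord (i : 'I_d) :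
  measurable_fun setT (fun x : 'rV[R]_d => x ord0 i).
Proof.
apply: (measurability _ (RGenOpens.measurableE R)).
move=> _ [_ [a [b ->]] <-]; rewrite setTI; apply: open_measurable_rV.
apply: open_comp; last exact: interval_open.
by move=> x _; exact: coord_continuous.
Qed.

Let ratbox (q : 'rV[rat]_d * nat) : set 'rV[R]_d :=
  ball (map_mx ratr q.1 : 'rV[R]_d) (q.2.+1%:R^-1).

Let open_ratbox (A : set 'rV[R]_d) : open A ->
  A = \bigcup_q [set x | ratbox q `<=` A /\ ratbox q x].
Proof.
move=> oA; apply/seteqP; split; last by move=> x [q _ /= [qA xq]]; exact: qA.
move=> x Ax.
have /nbhs_ballP[e /= e0 xeA] := open_nbhs_nbhs (conj oA Ax).
have [k ke] : exists k : nat, k.+1%:R^-1 < e / 2 :> R.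
  exists (Num.truncn (e / 2)^-1).
  by rewrite invf_plt ?posrE ?divr_gt0 ?ltr0n// real_truncnS_gt ?num_real.
have /choice[q qP] (i : 'I_d) :
    exists q : rat, `|ratr q - x ord0 i| < k.+1%:R^-1 :> R.
  have k0 : (0 : R) < k.+1%:R^-1 by rewrite invr_gt0 ltr0n.
  have [|q] := @rat_in_itvoo _ (x ord0 i - k.+1%:R^-1) (x ord0 i + k.+1%:R^-1).
    by rewrite ltrBlDr -addrA ltrDl addr_gt0.
  by rewrite in_itv/= => qx; exists q; rewrite ltr_distl.
have bx : ratbox (\row_i q i, k) x.
  split; first by rewrite invr_gt0 ltr0n.
  by move=> i j; rewrite ord1 !mxE; exact: qP.
exists (\row_i q i, k) => //=; split => // y qy; apply: xeA.
apply: (@le_ball _ _ _ (k.+1%:R^-1 + k.+1%:R^-1)).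
  by rewrite (splitr e) lerD// ltW.
by apply: ball_triangle qy; exact: ball_sym.
Qed.

Lemma measurable_fun_rV d1 (T : measurableType d1) (f : T -> 'rV[R]_d) :
  (forall i, measurable_fun setT (fun x => f x ord0 i)) ->
  measurable_fun setT f.
Proof.
move=> mf; apply: (@measurability _ _ _ _ _ _ (@open 'rV[R]_d)) => //.
move=> _ [B oB <-]; rewrite setTI (open_ratbox oB) preimage_bigcup.
apply: countable_bigcupT_measurable; first exact: countableP.
move=> q.
have [qB|qB] := pselect (ratbox q `<=` B); last first.
  by rewrite [X in measurable X](_ : _ = set0)// -subset0 => x [].
rewrite [X in measurable X](_ : _ = \bigcap_(i in [set: 'I_d])
   ((fun x => f x ord0 i) @^-1` ball (ratr (q.1 ord0 i) : R) (q.2.+1%:R^-1))).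
  apply: fin_bigcap_measurable => // i _; rewrite -[X in measurable X]setTI.
  by apply: mf => //; apply: open_measurable; exact: ball_open.
apply/seteqP; split => [x [_ [_ fx]] i _ /=|x fx /=].
  by have := fx ord0 i; rewrite mxE.
split=> //; split; first by rewrite invr_gt0 ltr0n.
by move=> i j; rewrite ord1 mxE; exact: fx.
Qed.

End rV_borel.

Section lebesgue_rV.
Context (R : realType).
Local Open Scope ereal_scope.

Section step.
Context (d : nat) (m : {sigma_finite_measure set 'rV[R]_d -> \bar R}).

Definition cons_rV (p : measurableTypeR R * 'rV[R]_d) : 'rV[R]_d.+1 :=
  \row_(i < d.+1) if unlift ord0 i is Some j then p.2 ord0 j else p.1.

Lemma measurable_cons_rV : measurable_fun setT cons_rV.
Proof.
apply: measurable_fun_rV => i; under eq_fun do rewrite mxE.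
case: unliftP => [k _|_]; last exact: measurable_fst.
rewrite (_ : (fun _ => _) = (fun x : 'rV[R]_d => x ord0 k) \o snd)//.
by apply: measurableT_comp => //; exact: measurable_coord.
Qed.

Definition lebesgue_step : set 'rV[R]_d.+1 -> \bar R :=
  pushforward (@lebesgue_measure R \x m) cons_rV.

Let step0 : lebesgue_step set0 = 0.
Proof. by rewrite /lebesgue_step /pushforward preimage_set0 measure0. Qed.

Let step_ge0 A : 0 <= lebesgue_step A.
Proof. exact: (measure_ge0 (@lebesgue_measure R \x m)). Qed.

Let step_sigma_additive : semi_sigma_additive lebesgue_step.
Proof.
move=> F mF tF mUF; rewrite /lebesgue_step /pushforward preimage_bigcup.
have mcons A : measurable A -> measurable (cons_rV @^-1` A).
  by move=> mA; rewrite -[X in measurable X]setTI; exact: measurable_cons_rV.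
apply: measure_semi_sigma_additive.
- by move=> n; exact: mcons.
- apply/trivIsetP => /= i j _ _ ij; rewrite -preimage_setI.
  by move/trivIsetP : tF => /(_ _ _ _ _ ij) ->//; rewrite preimage_set0.
- by rewrite -preimage_bigcup; exact: mcons.
Qed.

HB.instance Definition _ := isMeasure.Build _ _ _ lebesgue_step
  step0 step_ge0 step_sigma_additive.

Let uncons_rV (x : 'rV[R]_d.+1) : measurableTypeR R * 'rV[R]_d :=
  (x ord0 ord0, \row_j x ord0 (lift ord0 j)).

Let measurable_uncons_rV : measurable_fun setT uncons_rV.
Proof.
apply/measurable_fun_pairP; split => /=; first exact: measurable_coord.
apply: measurable_fun_rV => i.
under eq_fun do rewrite mxE; exact: measurable_coord.
Qed.

Let cons_rVK : cancel cons_rV uncons_rV.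
Proof.
move=> [a x]; rewrite /uncons_rV mxE unlift_none; congr (_, _).
by apply/rowP => j; rewrite !mxE liftK.
Qed.

Let step_sigma_finite : sigma_finite setT lebesgue_step.
Proof.
pose L : {sigma_finite_measure set (measurableTypeR R) -> \bar R} :=
  @lebesgue_measure R.
have [F FT mF] : sigma_finite setT (L \x m).
  have /sigma_finiteP[F [TF ndF Foo]] := sigma_finiteT L.
  have /sigma_finiteP[G [TG ndG Goo]] := sigma_finiteT m.
  exists (fun n => F n `*` G n).
    rewrite -setXTT TF TG predeqE => -[x y]; split.
      move=> [/= [n _ Fnx] [k _ Gky]]; exists (maxn n k) => //; split.
        by move: x Fnx; exact/subsetPset/ndF/leq_maxl.
      by move: y Gky; exact/subsetPset/ndG/leq_maxr.
    by move=> [n _ []/= ? ?]; split; exists n.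
  move=> k; have [? ?] := Foo k; have [? ?] := Goo k.
  split; first exact: measurableX.
  by rewrite product_measure1E// lte_mul_pinfty// ge0_fin_numE.
exists (fun i => uncons_rV @^-1` F i); first by rewrite -preimage_bigcup -FT.
move=> i; have [mFi Fioo] := mF i; split.
  by rewrite -[X in measurable X]setTI; exact: measurable_uncons_rV.
rewrite /lebesgue_step /pushforward -comp_preimage.
rewrite (_ : uncons_rV \o cons_rV = id) ?preimage_id//.
by apply/funext => p; exact: cons_rVK.
Qed.

HB.instance Definition _ := Measure_isSigmaFinite.Build _ _ _ lebesgue_step
  step_sigma_finite.

End step.

(* Lebesgue measure on R^d: the d-fold product of the one on R, transported to
   row vectors; lebesgue_rV_box computes it on boxes. *)
Fixpoint lebesgue_rV (d : nat) :
    {sigma_finite_measure set 'rV[R]_d -> \bar R} :=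
  match d with
  | 0%N => \d_(0%R : 'rV[R]_0)
  | d'.+1 => lebesgue_step (lebesgue_rV d')
  end.

Lemma lebesgue_rVS d (A : set 'rV[R]_d.+1) :
  lebesgue_rV d.+1 A =
  \int[@lebesgue_measure R]_a
    lebesgue_rV d [set x : 'rV[R]_d | A (cons_rV (a, x))].
Proof.
apply: eq_integral => a _ /=; congr (lebesgue_rV d _).
by apply/seteqP; split => x; rewrite /xsection /= inE.
Qed.

Lemma lebesgue_rV_box d (a b : 'I_d -> R) : (forall i, a i <= b i)%R ->
  lebesgue_rV d [set x : 'rV[R]_d | forall i, x ord0 i \in `[a i, b i]] =
  (\prod_i (b i - a i))%:E.
Proof.
elim: d a b => [|d IH] a b ab.
  by rewrite big_ord0 /= diracE mem_set// => -[].
rewrite lebesgue_rVS big_ord_recl.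
pose V := (\prod_(i < d) (b (lift ord0 i) - a (lift ord0 i)))%R.
pose I : set (measurableTypeR R) := `[a ord0, b ord0]%classic.
have mI : measurable I by exact: measurable_itv.
transitivity (\int[@lebesgue_measure R]_t (V%:E * (\1_I t)%:E)).
  apply: eq_integral => t _; rewrite indicE; case: (boolP (t \in I)) => tab.
    rewrite mule1 /V -(IH (a \o lift ord0) (b \o lift ord0)); last first.
      by move=> i; exact: ab.
    congr (lebesgue_rV d _); apply/seteqP; split => x /= xab i.
      by have := xab (lift ord0 i); rewrite mxE liftK.
    rewrite mxE; case: unliftP => [j ->|->]; first exact: xab.
    by move: tab; rewrite inE.
  rewrite mule0 [X in lebesgue_rV d X](_ : _ = set0) ?measure0//.
  rewrite -subset0 => x /= /(_ ord0); rewrite mxE unlift_none => tab'.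
  by move/negP: tab; apply; rewrite inE.
rewrite ge0_integralZl//; last 2 first.
- by apply/measurable_EFinP; exact: (measurable_indic mI).
- by rewrite lee_fin prodr_ge0// => i _; rewrite subr_ge0.
rewrite integral_indic//= setIT lebesgue_measure_itv/= lte_fin muleC.
case: ltP => [_|ba]; first by rewrite -EFinD -EFinM.
have -> : a ord0 = b ord0 by apply/eqP; rewrite eq_le ab ba.
by rewrite subrr mul0r mul0e.
Qed.

End lebesgue_rV.

(* R[i] with the topology given by its norm. *)
Definition Cplx (R : realType) : numClosedFieldType := R[i].

Section multipliers.
Context (R : realType).
Local Notation C := R[i].

Definition abs2 (z : C) : R := complex.Re z ^+ 2 + complex.Im z ^+ 2.

Definition expi (t : R) : C := (cos t +i* sin t)%C.

Definition in_L2 disp (T : measurableType disp)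
    (mu : {measure set T -> \bar R}) (D : set T) (g : T -> C) : Prop :=
  [/\ measurable_fun D (fun x => complex.Re (g x)),
      measurable_fun D (fun x => complex.Im (g x)) &
      (\int[mu]_(x in D) (abs2 (g x))%:E < +oo)%E].

Section space.
Context (d n : nat).
Local Notation leb := (lebesgue_rV R d).

Definition fourier (u : 'rV[R]_d -> C) (xi : 'rV[R]_d) : C :=
  let g x := u x * expi (- \sum_(j < d) x ord0 j * xi ord0 j) in
  ((\int[leb]_x complex.Re (g x))%R +i* (\int[leb]_x complex.Im (g x))%R)%C.

Definition unit_cube : set 'rV[R]_d :=
  [set x | forall j, 0 <= x ord0 j <= 1].

Definition supported_in (A : set 'rV[R]_d) (u : 'rV[R]_d -> C) : Prop :=
  {ae leb, forall x, ~ A x -> u x = 0}.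

Definition lincomb (f : 'I_n -> 'rV[R]_d -> C) (c : 'rV[C]_n) :
    'rV[R]_d -> C := fun x => \sum_(i < n) c ord0 i * f i x.

Definition span_of (f : 'I_n -> 'rV[R]_d -> C) : set ('rV[R]_d -> C) :=
  range (lincomb f).

Definition L2_independent (u : 'I_n -> 'rV[R]_d -> C) : Prop :=
  forall c : 'rV[C]_n, {ae leb, forall x, lincomb u c x = 0} -> c = 0.

(* For linearly independent f, c |-> lincomb f c is a bijection from C^n to
   the span of f, and it is isometric when the span is normed by the Euclidean
   norm of the coefficients; on C^n that norm induces the matrix topology. *)
Definition compact_in_span (f : 'I_n -> 'rV[R]_d -> C)
    (S : set ('rV[R]_d -> C)) : Prop :=
  S `<=` span_of f /\ compact [set c : 'rV[Cplx R]_n | S (lincomb f c)].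

(* The squared L^2 norm as a real number: by Plancherel the integral is finite
   on the span of Fourier transforms of L^2 functions. *)
Definition L2_norm2 (v : 'rV[R]_d -> C) : R := \int[leb]_x abs2 (v x).

Definition L2_norm_equivalent (mu : {measure set 'rV[R]_d -> \bar R})
    (V : set ('rV[R]_d -> C)) : Prop :=
  exists c K : R, [/\ 0 < c, 0 < K & forall v, V v ->
    ((c * L2_norm2 v)%:E <= \int[mu]_xi (abs2 (v xi))%:E <=
     (K * L2_norm2 v)%:E)%E].

Definition dilate (alpha : R) (v : 'rV[R]_d -> C) : 'rV[R]_d -> C :=
  fun xi => v (alpha *: xi).

Section error.
Context (mu : {measure set 'rV[R]_d -> \bar R}) (Omega0 : set 'rV[R]_d)
  (alpha : R).
Local Open Scope ereal_scope.

Definition mult_error (v m : 'rV[R]_d -> C) : \bar R :=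
  (2^-1)%:E *
  \int[mu]_(xi in Omega0) (abs2 (dilate alpha v xi - m xi * v xi)%R)%:E.

Definition worst_case_error (S : set ('rV[R]_d -> C)) (m : 'rV[R]_d -> C) :
    \bar R :=
  ereal_sup [set mult_error v m | v in S].

(* Competitors range over L^2(Omega0, mu): when mu is not absolutely continuous,
   the error is not a function of Lebesgue classes of m. *)
Definition worst_case_optimal (S : set ('rV[R]_d -> C))
    (m : 'rV[R]_d -> C) : Prop :=
  in_L2 mu Omega0 m /\
  forall m', in_L2 mu Omega0 m' ->
    worst_case_error S m <= worst_case_error S m'.

End error.

Definition cdot (x y : 'cV[C]_n) : C :=
  \sum_(k < n) (x k ord0)^* * y k ord0.

Definition psd_hermitian (Sigma : 'M[C]_n) : Prop :=
  Sigma \is hermsymmx /\ forall x : 'cV[C]_n, 0 <= cdot x (Sigma *m x).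

Definition vec (f : 'I_n -> 'rV[R]_d -> C) (xi : 'rV[R]_d) : 'cV[C]_n :=
  \col_i f i xi.

End space.
End multipliers.

(* Main.v *)
Require Import Defs.
From mathcomp Require Import all_boot all_order all_algebra.
From mathcomp Require Import all_classical all_reals all_analysis.
From mathcomp Require Import measurable_realfun complex ring lra.

Set Implicit Arguments.
Unset Strict Implicit.
Unset Printing Implicit Defensive.

Import Order.TTheory GRing.Theory Num.Theory.
Import numFieldNormedType.Exports.

Local Open Scope classical_set_scope.
Local Open Scope ring_scope.

(** Both assertions rest on one feature of the worst-case error E_S: for fixed
    v the error E(v, m) is a quadratic functional of m whose quadratic part is
    the integral of |v|^2 |m|^2, so E_S is a supremum of convex quadratic
    functionals.

    Existence. Omega0 is compact and the elements of S are continuous with no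
    common zero there, so finitely many of them satisfy sum |v_j|^2 >= delta on
    Omega0, and a bound on E_S(m) bounds m in L^2 ([sublevel_bounded]). Weak
    compactness of balls is avoided: the sublevel sets of E_S are convex, hence
    by the parallelogram identity elements of almost minimal norm in sublevel
    sets that shrink to the optimal level form a Cauchy sequence, a fast
    subsequence of which converges almost everywhere, and Fatou's lemma shows
    that the limit is optimal ([sublevel_min]).

    Representation. Write w = D_alpha f - m f for an optimal m. For the rank-one
    matrix Sigma of v = sum c_i f_i, with entries c_k^* c_l, one has
    |D_alpha v - m v|^2 = (w, Sigma w), so E(v, m) is the value at Sigma of a
    linear functional E(Sigma), and (f, Sigma w) is minus the gradient of the
    error in the direction of m. The set Q of positive semidefinite Sigma with
    bounded entries and E(Sigma) <= E_S(m) is compact, convex, and contains all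
    the rank-one matrices of S. Let Sigma0 maximize over Q the concave function
    E(Sigma) - ||(f, Sigma w)||^2 / (2 L), where L bounds |v|^2 on Omega0 for
    all v in S. The first-order condition at Sigma0, tested on the rank-one
    matrices, says that the competitor m + (f, Sigma0 w) / L satisfies
    E_S <= E(Sigma0) - ||(f, Sigma0 w)||^2 / (2 L) <= E_S(m) - (the same square).
    Optimality of m then forces (f, Sigma0 w) = 0 almost everywhere, which is
    the announced quotient, and E(Sigma0) = E_S(m) ([stationary_matrix]). If
    E_S(m) = 0, then already D_alpha v = m v for each v in S, and the rank-one
    matrix of any nonzero v can be used.

    Nonvanishing of the denominator. For a positive semidefinite Sigma,
    (f, Sigma f) vanishes only where the vector Sigma f does
    ([psd_form_eq0]), and when E(Sigma) > 0 some component of Sigma f is not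
    identically zero. Such a component is in the span of Fourier transforms of
    functions supported in the unit cube, so along coordinate lines its
    derivatives of all orders are bounded by one constant; zeros of such a
    function on a line are countable ([countable_zeros]), and slicing gives a
    Lebesgue-null zero set in R^d ([lebesgue_zeros]). *)

(** * The complex numbers as a Euclidean plane *)

Section complex_plane.
Context {R : realType}.
Implicit Types x y z : R[i].

(** The real part of x^* y. Expanding |x + r y|^2 for real r involves only this
    part of the Hermitian product, so all of the L^2 geometry below is done
    over the real numbers. *)
Definition rdot x y : R :=
  complex.Re x * complex.Re y + complex.Im x * complex.Im y.

Lemma cReD x y : complex.Re (x + y) = complex.Re x + complex.Re y.
Proof. by case: x y => [a b] [c d]. Qed.

Lemma cImD x y : complex.Im (x + y) = complex.Im x + complex.Im y.
Proof. by case: x y => [a b] [c d]. Qed.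

Lemma cReM x y : complex.Re (x * y) =
  complex.Re x * complex.Re y - complex.Im x * complex.Im y.
Proof. by case: x y => [a b] [c d]. Qed.

Lemma cImM x y : complex.Im (x * y) =
  complex.Re x * complex.Im y + complex.Im x * complex.Re y.
Proof. by case: x y => [a b] [c d]. Qed.

Lemma cReZ (r : R) x : complex.Re (r%:C%C * x) = r * complex.Re x.
Proof. by case: x => a b /=; rewrite mul0r subr0. Qed.

Lemma cImZ (r : R) x : complex.Im (r%:C%C * x) = r * complex.Im x.
Proof. by case: x => a b /=; rewrite mul0r addr0. Qed.

Lemma cRe_sum (I : Type) (s : seq I) (F : I -> R[i]) :
  complex.Re (\sum_(i <- s) F i) = \sum_(i <- s) complex.Re (F i).
Proof. by apply: (big_morph (@complex.Re R)); [exact: cReD|]. Qed.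

Lemma cIm_sum (I : Type) (s : seq I) (F : I -> R[i]) :
  complex.Im (\sum_(i <- s) F i) = \sum_(i <- s) complex.Im (F i).
Proof. by apply: (big_morph (@complex.Im R)); [exact: cImD|]. Qed.

Lemma conjCD x y : (x + y)^* = x^* + y^*.
Proof.
by case: x y => [a b] [c d]; apply/eqP; rewrite eq_complex/= opprD !eqxx.
Qed.

Lemma conjCM x y : (x * y)^* = x^* * y^*.
Proof.
case: x y => [a b] [c d]; apply/eqP; rewrite eq_complex/=.
by apply/andP; split; apply/eqP; ring.
Qed.

Lemma conjC_sum (I : Type) (s : seq I) (F : I -> R[i]) :
  (\sum_(i <- s) F i)^* = \sum_(i <- s) (F i)^*.
Proof.
apply: (big_morph (fun x : R[i] => x^*)); first exact: conjCD.
exact: conjC0.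
Qed.

Lemma conjC_real (r : R) : (r%:C%C)^* = r%:C%C.
Proof. by apply/eqP; rewrite eq_complex/= oppr0 !eqxx. Qed.

Lemma abs2_ge0 x : 0 <= abs2 x.
Proof. by rewrite /abs2 addr_ge0 ?sqr_ge0. Qed.

Lemma abs2_eq0 x : abs2 x = 0 -> x = 0.
Proof.
case: x => a b /eqP; rewrite /abs2/= paddr_eq0 ?sqr_ge0// !sqrf_eq0.
by move=> /andP[/eqP -> /eqP ->].
Qed.

Lemma abs20 : abs2 (0 : R[i]) = 0.
Proof. by rewrite /abs2/=; ring. Qed.

Lemma abs2N x : abs2 (- x) = abs2 x.
Proof. by case: x => a b; rewrite /abs2/=; ring. Qed.

Lemma abs2M x y : abs2 (x * y) = abs2 x * abs2 y.
Proof. by case: x y => [a b] [c d]; rewrite /abs2/=; ring. Qed.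

Lemma abs2J x : abs2 x^* = abs2 x.
Proof. by case: x => a b; rewrite /abs2/=; ring. Qed.

Lemma abs2D x y : abs2 (x + y) = abs2 x + 2 * rdot x y + abs2 y.
Proof. by case: x y => [a b] [c d]; rewrite /abs2 /rdot/=; ring. Qed.

Lemma ler_abs2D x y : abs2 (x + y) <= 2 * abs2 x + 2 * abs2 y.
Proof.
case: x y => [a b] [c d]; rewrite /abs2/= -subr_ge0.
have -> : 2 * (a ^+ 2 + b ^+ 2) + 2 * (c ^+ 2 + d ^+ 2)
    - ((a + c) ^+ 2 + (b + d) ^+ 2) = (a - c) ^+ 2 + (b - d) ^+ 2 by ring.
by rewrite addr_ge0 ?sqr_ge0.
Qed.

Lemma rdotxx x : rdot x x = abs2 x.
Proof. by rewrite /rdot /abs2 !expr2. Qed.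

Lemma rdotC x y : rdot x y = rdot y x.
Proof. by rewrite /rdot; ring. Qed.

Lemma rdot_ReJ x y : rdot x y = complex.Re (x^* * y).
Proof. by case: x y => [a b] [c d]; rewrite /rdot/=; ring. Qed.

Lemma ler_rdot x y : `|rdot x y| <= abs2 x + abs2 y.
Proof.
have := abs2_ge0 (x + y); have := abs2_ge0 (x - y).
rewrite !abs2D abs2N (_ : rdot x (- y) = - rdot x y); last first.
  by case: x y => [a b] [c d]; rewrite /rdot/=; ring.
have := abs2_ge0 x; have := abs2_ge0 y.
by rewrite ler_norml => *; apply/andP; split; lra.
Qed.

Lemma rdotDl x y z : rdot (x + y) z = rdot x z + rdot y z.
Proof. by rewrite /rdot cReD cImD; ring. Qed.

Lemma rdotZl (r : R) x y : rdot (r%:C%C * x) y = r * rdot x y.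
Proof. by rewrite /rdot cReM cImM/=; ring. Qed.

End complex_plane.

(** * Square-integrable functions as a real inner product space *)

Section square_integrable.
Context {R : realType} {disp : measure_display} {T : measurableType disp}.
Variables (mu : {measure set T -> \bar R}) (D : set T).
Hypothesis mD : measurable D.
Implicit Types g h : T -> R[i].

Definition cmeasurable g := measurable_fun D (fun x => complex.Re (g x)) /\
  measurable_fun D (fun x => complex.Im (g x)).

Lemma cmeasurableD g h : cmeasurable g -> cmeasurable h ->
  cmeasurable (fun x => g x + h x).
Proof.
move=> [g1 g2] [h1 h2]; split.
  by under eq_fun do rewrite cReD; exact: measurable_funD.
by under eq_fun do rewrite cImD; exact: measurable_funD.
Qed.

Lemma cmeasurableM g h : cmeasurable g -> cmeasurable h ->
  cmeasurable (fun x => g x * h x).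
Proof.
move=> [g1 g2] [h1 h2]; split.
  under eq_fun do rewrite cReM.
  by apply: measurable_funB; exact: measurable_funM.
under eq_fun do rewrite cImM.
by apply: measurable_funD; exact: measurable_funM.
Qed.

Lemma cmeasurable_cst (c : R[i]) : cmeasurable (cst c).
Proof. by split; exact: measurable_cst. Qed.

Lemma cmeasurableJ g : cmeasurable g -> cmeasurable (fun x => (g x)^*).
Proof.
move=> [g1 g2]; split.
  rewrite (_ : (fun _ => _) = (fun x => complex.Re (g x)))//.
  by apply/funext => x; case: (g x).
rewrite (_ : (fun _ => _) = (fun x => - complex.Im (g x))).
  exact: measurableT_comp.
by apply/funext => x; case: (g x).
Qed.

Lemma cmeasurable_sum (I : Type) (s : seq I) (F : I -> T -> R[i]) :
  (forall i, cmeasurable (F i)) -> cmeasurable (fun x => \sum_(i <- s) F i x).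
Proof.
move=> mF; elim: s => [|i s IH].
  by under eq_fun do rewrite big_nil; exact: cmeasurable_cst.
by under eq_fun do rewrite big_cons; exact: cmeasurableD.
Qed.

Lemma measurable_rdot g h : cmeasurable g -> cmeasurable h ->
  measurable_fun D (fun x => rdot (g x) (h x)).
Proof.
move=> [g1 g2] [h1 h2].
by apply: measurable_funD; exact: measurable_funM.
Qed.

Lemma measurable_abs2 g : cmeasurable g -> measurable_fun D (fun x => abs2 (g x)).
Proof.
by move=> mg; under eq_fun do rewrite -rdotxx; exact: measurable_rdot.
Qed.

Lemma L2_cmeasurable g : in_L2 mu D g -> cmeasurable g.
Proof. by case=> g1 g2 _; split. Qed.

Lemma L2_integrable g : in_L2 mu D g ->
  mu.-integrable D (EFin \o (fun x => abs2 (g x))).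
Proof.
move=> [g1 g2 g3]; apply/integrableP; split.
  by apply/measurable_EFinP; apply: measurable_abs2.
rewrite (eq_integral (fun x => (abs2 (g x))%:E))// => x _.
by rewrite /= ger0_norm ?abs2_ge0.
Qed.

Lemma L2_dominated g (phi : T -> R) : cmeasurable g ->
  mu.-integrable D (EFin \o phi) -> (forall x, D x -> abs2 (g x) <= phi x) ->
  in_L2 mu D g.
Proof.
move=> mg iphi gphi; split; [exact: mg.1|exact: mg.2|].
have /integrableP[mphi] := iphi; apply: le_lt_trans.
apply: ge0_le_integral => //.
- by move=> x _; rewrite lee_fin abs2_ge0.
- by apply/measurable_EFinP; apply: measurable_abs2.
- by apply: measurableT_comp.
- by move=> x Dx; rewrite /= lee_fin (le_trans (gphi _ Dx))// ler_norm.
Qed.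

Lemma L2D g h : in_L2 mu D g -> in_L2 mu D h ->
  in_L2 mu D (fun x => g x + h x).
Proof.
move=> Lg Lh.
apply: (@L2_dominated _ (fun x => 2 * abs2 (g x) + 2 * abs2 (h x))).
- by apply: cmeasurableD; exact: L2_cmeasurable.
- rewrite (_ : _ \o _ = (fun x => 2%:E * (EFin \o (fun x => abs2 (g x))) x) \+
     (fun x => 2%:E * (EFin \o (fun x => abs2 (h x))) x))%E//.
  by apply: integrableD => //; apply: integrableZl => //; exact: L2_integrable.
- by move=> x _; exact: ler_abs2D.
Qed.

Lemma L2_bounded_mul (b g : T -> R[i]) (K : R) : cmeasurable b ->
  (forall x, D x -> abs2 (b x) <= K) -> in_L2 mu D g ->
  in_L2 mu D (fun x => b x * g x).
Proof.
move=> mb bK Lg; apply: (@L2_dominated _ (fun x => K * abs2 (g x))).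
- by apply: cmeasurableM => //; exact: L2_cmeasurable.
- rewrite (_ : _ \o _ = (fun x => K%:E * (EFin \o (fun x => abs2 (g x))) x)%E)//.
  by apply: integrableZl => //; exact: L2_integrable.
- by move=> x Dx; rewrite abs2M ler_wpM2r ?abs2_ge0// bK.
Qed.

Lemma L2Z (c : R[i]) g : in_L2 mu D g -> in_L2 mu D (fun x => c * g x).
Proof. exact: (@L2_bounded_mul (cst c) g (abs2 c) (cmeasurable_cst c)). Qed.

Lemma L2N g : in_L2 mu D g -> in_L2 mu D (fun x => - g x).
Proof.
by move=> /(L2Z (-1)); under [X in in_L2 _ _ X -> _]eq_fun do rewrite mulN1r.
Qed.

Lemma L2B g h : in_L2 mu D g -> in_L2 mu D h ->
  in_L2 mu D (fun x => g x - h x).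
Proof. by move=> Lg Lh; apply: L2D => //; exact: L2N. Qed.

Lemma L20 : in_L2 mu D (cst 0).
Proof.
split; [exact: measurable_cst..|].
by rewrite integral0_eq// => x _; rewrite abs20.
Qed.

Lemma L2_sum (I : Type) (s : seq I) (F : I -> T -> R[i]) :
  (forall i, in_L2 mu D (F i)) -> in_L2 mu D (fun x => \sum_(i <- s) F i x).
Proof.
move=> mF; elim: s => [|i s IH].
  by under eq_fun do rewrite big_nil; exact: L20.
by under eq_fun do rewrite big_cons; exact: L2D.
Qed.

Lemma integrable_rdot g h : in_L2 mu D g -> in_L2 mu D h ->
  mu.-integrable D (EFin \o (fun x => rdot (g x) (h x))).
Proof.
move=> Lg Lh; have [Ig Ih] := (L2_integrable Lg, L2_integrable Lh).
apply: le_integrable (integrableD mD Ig Ih) => //.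
  by apply/measurable_EFinP; apply: measurable_rdot;
    [exact: L2_cmeasurable Lg|exact: L2_cmeasurable Lh].
move=> x _ /=; rewrite lee_fin [leRHS]ger0_norm ?(addr_ge0 (abs2_ge0 _) (abs2_ge0 _))//.
exact: ler_rdot.
Qed.

Lemma integrable_Rsum (I : Type) (s : seq I) (h : I -> T -> R) :
  (forall i, mu.-integrable D (EFin \o h i)) ->
  mu.-integrable D (EFin \o (fun x => \sum_(i <- s) h i x)).
Proof.
move=> ih; elim: s => [|i s IH].
  rewrite (_ : _ \o _ = cst 0%E); first exact: integrable0.
  by apply/funext => x /=; rewrite big_nil.
pose S x := \sum_(i <- s) h i x.
rewrite (_ : _ \o _ = ((EFin \o h i) \+ (EFin \o S))%E).
  exact: integrableD.
by apply/funext => x /=; rewrite big_cons.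
Qed.

Lemma Rintegral_sum (I : Type) (s : seq I) (h : I -> T -> R) :
  (forall i, mu.-integrable D (EFin \o h i)) ->
  \int[mu]_(x in D) (\sum_(i <- s) h i x) =
  \sum_(i <- s) \int[mu]_(x in D) h i x.
Proof.
move=> ih; elim: s => [|i s IH].
  rewrite big_nil; under eq_Rintegral do rewrite big_nil.
  by rewrite Rintegral_cst// mul0r.
rewrite big_cons; under eq_Rintegral do rewrite big_cons.
by rewrite RintegralD ?IH//; exact: integrable_Rsum.
Qed.

Lemma integrable_RD (g h : T -> R) : mu.-integrable D (EFin \o g) ->
  mu.-integrable D (EFin \o h) ->
  mu.-integrable D (EFin \o (fun x => g x + h x)).
Proof. by move=> ig ih; exact: (integrableD mD ig ih). Qed.

Lemma integrable_RB (g h : T -> R) : mu.-integrable D (EFin \o g) ->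
  mu.-integrable D (EFin \o h) ->
  mu.-integrable D (EFin \o (fun x => g x - h x)).
Proof. by move=> ig ih; exact: (integrableB mD ig ih). Qed.

Lemma integrable_RZ (r : R) (h : T -> R) : mu.-integrable D (EFin \o h) ->
  mu.-integrable D (EFin \o (fun x => r * h x)).
Proof. by move=> ih; exact: (integrableZl mD r ih). Qed.

Definition inner g h : R := \int[mu]_(x in D) rdot (g x) (h x).

Definition sqnorm g : R := \int[mu]_(x in D) abs2 (g x).

Lemma sqnorm_ge0 g : 0 <= sqnorm g.
Proof. by apply: Rintegral_ge0 => x _; exact: abs2_ge0. Qed.

Lemma sqnormE g : in_L2 mu D g ->
  (\int[mu]_(x in D) (abs2 (g x))%:E)%E = (sqnorm g)%:E.
Proof.
move=> Lg; rewrite fineK//.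
by apply: integrable_fin_num => //; exact: L2_integrable.
Qed.

Lemma innerC g h : inner g h = inner h g.
Proof. by apply: eq_Rintegral => x _; exact: rdotC. Qed.

Lemma innerxx g : inner g g = sqnorm g.
Proof. by apply: eq_Rintegral => x _; exact: rdotxx. Qed.

Lemma innerDl g1 g2 h : in_L2 mu D g1 -> in_L2 mu D g2 -> in_L2 mu D h ->
  inner (fun x => g1 x + g2 x) h = inner g1 h + inner g2 h.
Proof.
move=> L1 L2 Lh; rewrite -RintegralD//; try exact: integrable_rdot.
by apply: eq_Rintegral => x _; exact: rdotDl.
Qed.

Lemma innerZl (r : R) g h : in_L2 mu D g -> in_L2 mu D h ->
  inner (fun x => r%:C%C * g x) h = r * inner g h.
Proof.
move=> Lg Lh; rewrite -RintegralZl//; last exact: integrable_rdot.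
by apply: eq_Rintegral => x _; exact: rdotZl.
Qed.

Lemma inner0l h : inner (cst 0) h = 0.
Proof.
rewrite /inner (@eq_Rintegral _ _ _ _ _ (cst 0)); last first.
  by move=> x _; rewrite /rdot/=; ring.
by rewrite Rintegral_cst// mul0r.
Qed.

Lemma inner_suml (I : Type) (s : seq I) (r : I -> R) (F : I -> T -> R[i]) h :
  (forall i, in_L2 mu D (F i)) -> in_L2 mu D h ->
  inner (fun x => \sum_(i <- s) (r i)%:C%C * F i x) h =
  \sum_(i <- s) r i * inner (F i) h.
Proof.
move=> LF Lh; elim: s => [|i s IH].
  under [X in inner X _]eq_fun do rewrite big_nil.
  by rewrite big_nil; exact: inner0l.
under [X in inner X _]eq_fun do rewrite big_cons.
rewrite big_cons -IH -innerZl// innerDl//; first exact: L2Z.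
by apply: L2_sum => j; exact: L2Z.
Qed.

Lemma sqnormD g h : in_L2 mu D g -> in_L2 mu D h ->
  sqnorm (fun x => g x + h x) = sqnorm g + 2 * inner g h + sqnorm h.
Proof.
move=> Lg Lh.
have Lgh : in_L2 mu D (fun x => g x + h x) by exact: L2D.
rewrite -!innerxx innerDl// (innerC g) (innerC h) !innerDl// (innerC h g); ring.
Qed.

Lemma sqnormZ (r : R) g : in_L2 mu D g ->
  sqnorm (fun x => r%:C%C * g x) = r ^+ 2 * sqnorm g.
Proof.
move=> Lg; rewrite -!innerxx innerZl//; last exact: L2Z.
by rewrite innerC innerZl//; ring.
Qed.

Lemma le_sqnorm g h (K : R) : in_L2 mu D g -> in_L2 mu D h ->
  (forall x, D x -> abs2 (g x) <= K * abs2 (h x)) -> sqnorm g <= K * sqnorm h.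
Proof.
move=> Lg Lh gh; rewrite -RintegralZl//; last exact: L2_integrable.
apply: le_Rintegral => //; first exact: L2_integrable.
rewrite (_ : _ \o _ = (fun x => K%:E * (EFin \o (fun x => abs2 (h x))) x)%E)//.
by apply: integrableZl => //; exact: L2_integrable.
Qed.

Lemma sqnorm_eq0 g : in_L2 mu D g -> sqnorm g = 0 ->
  {ae mu, forall x, D x -> g x = 0}.
Proof.
move=> Lg g0.
have mg : measurable_fun D (EFin \o (fun x => abs2 (g x))).
  by apply/measurable_EFinP; apply: measurable_abs2; exact: L2_cmeasurable.
have /(ae_eq_integral_abs mu mD mg) : (\int[mu]_(x in D)
    `|(EFin \o (fun x => abs2 (g x))) x| = 0)%E.
  rewrite -[RHS]/(0%:E) -g0 -sqnormE//; apply: eq_integral => x _ /=.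
  by rewrite ger0_norm ?abs2_ge0.
apply: filterS => x /= + Dx => /(_ Dx) [].
exact: abs2_eq0.
Qed.

End square_integrable.

(** * Almost everywhere limits of square-integrable functions *)

Section ae_limits.
Context {R : realType} {disp : measure_display} {T : measurableType disp}.
Variables (mu : {measure set T -> \bar R}) (D : set T).
Hypothesis mD : measurable D.
Local Notation C := R[i].

Definition ae_cvg (p : nat -> T -> C) (q : T -> C) : Prop :=
  {ae mu, forall x, D x ->
    complex.Re (p r x) @[r --> \oo] --> complex.Re (q x) /\
    complex.Im (p r x) @[r --> \oo] --> complex.Im (q x)}.

Lemma ae_cvg_affine (p : nat -> T -> C) (q a b : T -> C) : ae_cvg p q ->
  ae_cvg (fun r x => a x - p r x * b x) (fun x => a x - q x * b x).
Proof.
apply: filterS => x /= + Dx => /(_ Dx) [cRe cIm].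
have cReB (y z : C) : complex.Re (y - z) = complex.Re y - complex.Re z.
  by case: y z => [? ?] [? ?].
have cImB (y z : C) : complex.Im (y - z) = complex.Im y - complex.Im z.
  by case: y z => [? ?] [? ?].
split.
  under eq_fun do rewrite cReB cReM; rewrite cReB cReM.
  apply: cvgB; first exact: cvg_cst.
  by apply: cvgB; apply: cvgM => //; exact: cvg_cst.
under eq_fun do rewrite cImB cImM; rewrite cImB cImM.
apply: cvgB; first exact: cvg_cst.
by apply: cvgD; apply: cvgM => //; exact: cvg_cst.
Qed.

(** Applied to the residuals a - m b, this makes an almost everywhere limit of
    near-minimizers a minimizer. *)
Lemma sqnorm_fatou (p : nat -> T -> C) (q : T -> C) (B : nat -> R) (b : R) :
  (forall r, in_L2 mu D (p r)) -> cmeasurable D q -> ae_cvg p q ->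
  (forall r, sqnorm mu D (p r) <= B r) -> B r @[r --> \oo] --> b ->
  in_L2 mu D q /\ sqnorm mu D q <= b.
Proof.
move=> Lp mq pq pB Bb.
have mp r : measurable_fun D (EFin \o (fun x => abs2 (p r x))).
  apply/measurable_EFinP; apply: measurable_abs2; exact: L2_cmeasurable (Lp r).
have qb : (\int[mu]_(x in D) (abs2 (q x))%:E <= b%:E)%E.
  rewrite (@ge0_ae_eq_integral _ _ _ mu D _
      (fun x => limn_einf (fun r => (abs2 (p r x))%:E)))//; first last.
  - apply: filterS pq => x /= + Dx => /(_ Dx) [cRe cIm].
    apply/esym; apply: (cvg_limn_einf_sup _).1.
    apply: cvg_EFin; first exact: nearW.
    by apply: cvgD; rewrite expr2; under eq_fun do rewrite expr2; exact: cvgM.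
  - move=> x Dx; rewrite limn_einf_lim; apply: lime_ge.
      exact: is_cvg_einfs.
    apply: nearW => r; apply: le_ereal_inf_tmp => _ [k _ <-].
    by rewrite lee_fin abs2_ge0.
  - by move=> x _; rewrite lee_fin abs2_ge0.
  - rewrite (_ : (fun x => _) =
      (fun x => - limn_esup (\- (fun r => (abs2 (p r x))%:E)))%E)//.
    apply: measurableT_comp => //; apply: measurable_fun_limn_esup => r.
    by apply: measurableT_comp => //; exact: mp.
  - by apply/measurable_EFinP; exact: measurable_abs2.
  apply: (le_trans (@fatou _ _ _ mu D mD (fun r x => (abs2 (p r x))%:E) mp _)).
    by move=> r x _; rewrite lee_fin abs2_ge0.
  have cB : (B r)%:E @[r --> \oo] --> b%:E by apply: cvg_EFin => //; exact: nearW.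
  rewrite -(cvg_limn_einf_sup cB).1 !limn_einf_lim; apply: lee_lim.
  - exact: is_cvg_einfs.
  - exact: is_cvg_einfs.
  apply: nearW => r; apply: le_ereal_inf_tmp => _ [k /= rk <-].
  apply: (@le_trans _ _ (\int[mu]_(x in D) (abs2 (p k x))%:E)%E).
    by apply: ereal_inf_lbound; exists k.
  by rewrite sqnormE// lee_fin.
have Lq : in_L2 mu D q.
  by split; [exact: mq.1|exact: mq.2|exact: le_lt_trans qb (ltry _)].
by split => //; rewrite -lee_fin -sqnormE.
Qed.

Lemma cvg_of_geometric_steps (u : nat -> R) (K : R) :
  (forall r, `|u r.+1 - u r| <= K * 2^-1 ^+ r) -> cvgn u.
Proof.
move=> uK.
rewrite (_ : u = fun r => u 0%N + series (telescope u) r); last first.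
  by apply/funext => r; exact: eq_sum_telescope.
apply: is_cvgD; first exact: is_cvg_cst.
apply: normed_cvg; apply: (@series_le_cvg _ _ (geometric K 2^-1)) => //.
- by move=> r /=; exact: normr_ge0.
- by move=> r; exact: le_trans (normr_ge0 _) (uK r).
- by apply: is_cvg_geometric_series; rewrite ger0_norm// invf_lt1// ltr1n.
Qed.

(** The series of the 4^r |p_(r+1) - p_r|^2 has a finite integral, hence is
    finite almost everywhere; where it is, its terms are bounded, and the
    increments of p are dominated by a geometric sequence of ratio 1/2. *)
Lemma L2_fast_cauchy_ae_cvg (p : nat -> T -> C) (c : R) :
  (forall r, in_L2 mu D (p r)) ->
  (forall r, sqnorm mu D (fun x => p r.+1 x - p r x) <= c * 8^-1 ^+ r) ->
  exists2 q, cmeasurable D q & ae_cvg p q.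
Proof.
move=> Lp pc.
(* upper limits are measurable without excluding the exceptional null set *)
pose q x : C := (fine (limn_esup (fun r => (complex.Re (p r x))%:E)) +i*
                 fine (limn_esup (fun r => (complex.Im (p r x))%:E)))%C.
exists q.
  split; apply: measurableT_comp => //; apply: measurable_fun_limn_esup => r;
    apply/measurable_EFinP; have [] := Lp r => //.
(* the weight 4^r is summable against 8^-r and forces a geometric decay *)
pose t r x : \bar R := (4 ^+ r * abs2 (p r.+1 x - p r x))%:E.
have Lg r : in_L2 mu D (fun x => p r.+1 x - p r x) by exact: L2B.
have mt r : measurable_fun D (t r).
  apply/measurable_EFinP; apply: measurable_funM => //.
  by apply: measurable_abs2; exact: L2_cmeasurable (Lg r).
have t0 r x : (0 <= t r x)%E.
  by rewrite lee_fin mulr_ge0 ?abs2_ge0// exprn_ge0.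
have int_t : (\int[mu]_(x in D) (\sum_(r <oo) t r x) < +oo)%E.
  rewrite integral_nneseries//.
  have c1 : (\sum_(r <oo) ((2 * c) / (2 ^ (r + 1))%:R)%:E < +oo)%E.
    have := @cvg_geometric_eseries_half R (2 * c) 0.
    by move/cvg_lim => ->//; exact: ltry.
  apply: le_lt_trans c1; apply: lee_nneseries => [r _ _|r _].
    exact: integral_ge0.
  rewrite /t; under eq_integral do rewrite EFinM.
  rewrite ge0_integralZl//; last 2 first.
  - by apply/measurable_EFinP; apply: measurable_abs2; exact: L2_cmeasurable (Lg r).
  - by move=> x _; rewrite lee_fin abs2_ge0.
  rewrite sqnormE// -EFinM lee_fin.
  have -> : 2 * c / (2 ^ (r + 1))%:R = 4 ^+ r * (c * 8^-1 ^+ r) :> R.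
    rewrite addn1 natrX exprS invfM mulrACA mulfV// mul1r mulrCA -exprMn.
    by rewrite -exprVn; congr (_ * _ ^+ _); lra.
  by rewrite ler_pM2l ?exprn_gt0.
have : mu.-integrable D (fun x => \sum_(r <oo) t r x)%E.
  apply/integrableP; split.
    by apply: ge0_emeasurable_sum => // r x Dx _.
  rewrite (eq_integral (fun x => \sum_(r <oo) t r x)%E)// => x _.
  by rewrite gee0_abs// nneseries_ge0.
move/(integrable_ae mD); apply: filterS => x /= + Dx => /(_ Dx) fin.
pose K := fine (\sum_(r <oo) t r x)%E.
have K0 : 0 <= K by rewrite fine_ge0// nneseries_ge0.
have tK r : 4 ^+ r * abs2 (p r.+1 x - p r x) <= K.
  rewrite -lee_fin -[leLHS]/(t r x) /K fineK//.
  apply: (@le_trans _ _ (\sum_(0 <= i < r.+1) t i x)%E).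
    by rewrite big_nat_recr//= leeDr// sume_ge0.
  by apply: nneseries_lim_ge => i _ _; exact: t0.
have cv (h : C -> R) : (forall y z, h (y - z) = h y - h z) ->
    (forall z, h z ^+ 2 <= abs2 z) ->
    h (p r x) @[r --> \oo] --> fine (limn_esup (fun r => (h (p r x))%:E)).
  move=> hB h2.
  have : cvgn (fun r => h (p r x)).
    apply: (@cvg_of_geometric_steps _ (K + 1)) => r.
    rewrite -hB -(@ler_pXn2r _ 2%N)// ?nnegrE ?mulr_ge0 ?addr_ge0 ?exprn_ge0//.
    rewrite real_normK ?num_real// (le_trans (h2 _))//.
    rewrite exprMn -exprM mulnC exprM.
    rewrite (_ : 2^-1 ^+ 2 = 4^-1 :> R); last by rewrite expr2; lra.
    rewrite exprVn ler_pdivlMr ?exprn_gt0// mulrC (le_trans (tK r))//.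
    by have := sqr_ge0 K; rewrite !expr2; nra.
  move=> /[dup] cvh /cvg_ex[l hl].
  have hlE : (h (p r x))%:E @[r --> \oo] --> l%:E.
    by apply: cvg_EFin => //; exact: nearW.
  by rewrite (cvg_limn_einf_sup hlE).2.
split; apply: cv => [y z|z].
- by case: y z => [? ?] [? ?].
- by rewrite /abs2 lerDl sqr_ge0.
- by case: y z => [? ?] [? ?].
- by rewrite /abs2 lerDr sqr_ge0.
Qed.

End ae_limits.

(** * Minimizers of a supremum of quadratic functionals *)

Section existence.
Context {R : realType} {disp : measure_display} {T : measurableType disp}.
Variables (mu : {measure set T -> \bar R}) (D : set T).
Hypothesis mD : measurable D.
Local Notation C := R[i].
Variables (I : Type) (S : set I) (a b : I -> T -> C).
Hypotheses (S0 : S !=set0) (La : forall v, S v -> in_L2 mu D (a v)).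
Hypothesis mb : forall v, S v -> cmeasurable D (b v).
Hypothesis bb : forall v, S v ->
  exists K : R, forall x, D x -> abs2 (b v x) <= K.

(** The level t is real, and the supremum over S is replaced by a family of
    inequalities, so that convexity and coercivity are statements about real
    numbers. *)
Definition sublevel (t : R) (m : T -> C) : Prop := in_L2 mu D m /\
  forall v, S v -> 2^-1 * sqnorm mu D (fun x => a v x - m x * b v x) <= t.

Lemma L2_residual v m : S v -> in_L2 mu D m ->
  in_L2 mu D (fun x => a v x - m x * b v x).
Proof.
move=> Sv Lm; apply: L2B => //; first exact: La.
have [K bK] := bb Sv.
under [X in in_L2 _ _ X]eq_fun do rewrite mulrC.
by apply: (@L2_bounded_mul _ _ _ _ _ mD _ _ K) => //; exact: mb.
Qed.

Lemma sqnorm_midpoint g h : in_L2 mu D g -> in_L2 mu D h ->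
  4 * sqnorm mu D (fun x => (2^-1)%:C%C * (g x + h x)) +
    sqnorm mu D (fun x => h x - g x) = 2 * sqnorm mu D g + 2 * sqnorm mu D h.
Proof.
move=> Lg Lh; rewrite sqnormZ//; last exact: L2D.
rewrite sqnormD//.
rewrite (_ : (fun x => h x - g x) = fun x => h x + (-1)%:C%C * g x); last first.
  by apply/funext => x; rewrite (_ : (-1)%:C%C = -1) ?mulN1r// rmorphN1.
rewrite sqnormD//; last exact: L2Z.
rewrite sqnormZ// (innerC mu D h) innerZl//; have -> : (2^-1 : R) ^+ 2 = 4^-1.
  by rewrite expr2; lra.
by rewrite expr2; field.
Qed.

(** Convexity of the worst-case error, in the only form needed for the
    parallelogram argument of [sublevel_min]. *)
Lemma sublevel_midpoint t g h : sublevel t g -> sublevel t h ->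
  sublevel t (fun x => (2^-1)%:C%C * (g x + h x)).
Proof.
move=> [Lg gt] [Lh ht]; split; first by apply: L2Z => //; exact: L2D.
move=> v Sv; have := gt v Sv; have := ht v Sv.
have := @sqnorm_midpoint _ _ (L2_residual Sv Lg) (L2_residual Sv Lh).
rewrite [in X in 4 * X](_ : (fun x => _) = fun x => a v x -
   ((2^-1)%:C%C * (g x + h x)) * b v x); last first.
  apply/funext => x.
  have half (z : C) : z = (2^-1)%:C%C * (z + z).
    case: z => y z; apply/eqP; rewrite eq_complex/=.
    by apply/andP; split; apply/eqP; field.
  by rewrite [X in _ = X - _]half; ring.
set n1 := sqnorm _ _ _; set n2 := sqnorm _ _ _; set n3 := sqnorm _ _ _.
set n4 := sqnorm _ _ _.
have : 0 <= n2 by exact: sqnorm_ge0.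
lra.
Qed.

Variables (s : seq I) (delta : R).
Hypotheses (sS : forall v, List.In v s -> S v) (delta0 : 0 < delta).
Hypothesis sb : forall x, D x -> delta <= \sum_(v <- s) abs2 (b v x).

(** Coercivity: delta |m|^2 is at most the sum of the |m b_v|^2, and m b_v is a_v
    minus a residual whose norm is controlled by t. *)
Lemma sublevel_bounded t : exists N : R,
  forall m, sublevel t m -> sqnorm mu D m <= N.
Proof.
have [N HN] : exists N : R, forall m, sublevel t m ->
    \int[mu]_(x in D) (\sum_(v <- s) abs2 (m x * b v x)) <= N /\
    mu.-integrable D (EFin \o (fun x => \sum_(v <- s) abs2 (m x * b v x))).
  elim: s sS => [_|v r IH rS].
    exists 0 => m _; split.
      under eq_Rintegral do rewrite big_nil.
      by rewrite Rintegral_cst// mul0r.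
    rewrite (_ : _ \o _ = cst 0%E); first exact: integrable0.
    by apply/funext => x /=; rewrite big_nil.
  have [|N HN] := IH; first by move=> w rw; apply: rS; right.
  have Sv : S v by apply: rS; left.
  exists (4 * t + 2 * sqnorm mu D (a v) + N) => m tm.
  have [Lm mt] := tm.
  have [mN im] := HN _ tm.
  have Lmb : in_L2 mu D (fun x => m x * b v x).
    rewrite (_ : (fun _ => _) =
      fun x => a v x - (a v x - m x * b v x)); last first.
      by apply/funext => x; rewrite subKr.
    apply: L2B => //; first exact: La.
    exact: L2_residual.
  have imb := L2_integrable Lmb.
  split; last first.
    pose h w x := abs2 (m x * b w x); pose H x := \sum_(w <- r) h w x.
    rewrite (_ : _ \o _ = ((EFin \o h v) \+ (EFin \o H))%E).
      exact: integrableD.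
    by apply/funext => x /=; rewrite big_cons.
  under eq_Rintegral do rewrite big_cons.
  rewrite RintegralD//; apply: lerD => //.
  rewrite -/(sqnorm mu D (fun x => m x * b v x)).
  have := @sqnorm_midpoint _ _ (La Sv) (L2N mD (L2_residual Sv Lm)).
  rewrite [in X in 4 * X](_ : (fun x => _) =
    fun x => (2^-1)%:C%C * (m x * b v x)); last first.
    by apply/funext => x; rewrite opprB addrC subrK.
  rewrite sqnormZ//.
  have -> : sqnorm mu D (fun x => - (a v x - m x * b v x)) =
      sqnorm mu D (fun x => a v x - m x * b v x).
    by apply: eq_Rintegral => x _; exact: abs2N.
  set n1 := sqnorm mu D (fun x => - _ - _).
  have : 0 <= n1 by exact: sqnorm_ge0.
  have := mt v Sv.
  rewrite (_ : (2^-1 : R) ^+ 2 = 4^-1); last by rewrite expr2; lra.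
  by rewrite mulrA mulfV// mul1r; lra.
exists (delta^-1 * N) => m tm; have [mN im] := HN _ tm.
rewrite ler_pdivlMl// (le_trans _ mN)// -RintegralZl//; last first.
  by apply: L2_integrable => //; exact: tm.1.
apply: le_Rintegral => //.
  by apply: integrable_RZ => //; apply: L2_integrable => //; exact: tm.1.
move=> x Dx; under eq_bigr do rewrite abs2M.
by rewrite -mulr_sumr mulrC ler_wpM2l ?abs2_ge0// sb.
Qed.

Lemma sublevel_ge0 t m : sublevel t m -> 0 <= t.
Proof.
move=> [_ H]; have [v Sv] := S0; apply: le_trans (H v Sv).
by rewrite mulr_ge0// sqnorm_ge0.
Qed.

Lemma sublevelW t t' m : t <= t' -> sublevel t m -> sublevel t' m.
Proof. by move=> tt' [Lm mt]; split => // v /mt /le_trans; apply. Qed.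

(** A substitute for weak compactness. The norm, as a function on a convex
    sublevel set, has near-minimizers that are close to each other by the
    parallelogram identity; letting the level decrease to its infimum i0
    makes the minimal norms increase, while coercivity keeps them bounded, so
    that the near-minimizers form a Cauchy sequence. *)
Lemma sublevel_min : (exists t m, sublevel t m) ->
  exists i0 m0, sublevel i0 m0 /\ forall t m, sublevel t m -> i0 <= t.
Proof.
move=> [t1 [m1 tm1]].
pose L : set R := [set t | exists m, sublevel t m].
have hL : has_inf L.
  split; first by exists t1; exists m1.
  by exists 0 => t [m]; exact: sublevel_ge0.
pose i0 := inf L.
have i0_le t m : sublevel t m -> i0 <= t.
  by move=> tm; apply: ge_inf; [exact: hL.2|exists m].
have ex eps : 0 < eps -> exists m, sublevel (i0 + eps) m.
  move=> e0; have [t [m tm] ti] := inf_adherent e0 hL.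
  by exists m; apply: sublevelW tm; exact: ltW.
pose A eps : set R := [set r | exists2 m, sublevel (i0 + eps) m & r = sqnorm mu D m].
have hA eps : 0 < eps -> has_inf (A eps).
  move=> /ex[m em]; split; first by exists (sqnorm mu D m); exists m.
  by exists 0 => _ [m' _ ->]; exact: sqnorm_ge0.
pose dist eps := inf (A eps).
have [N HN] := sublevel_bounded (i0 + 1).
pose E : set R := [set r | exists2 eps, 0 < eps <= 1 & r = dist eps].
have hE : has_sup E.
  split; first by exists (dist 1); exists 1 => //; rewrite ltr01 lexx.
  exists N => _ [eps /andP[e0 e1] ->].
  have [m em] := ex _ e0; apply: (@le_trans _ _ (sqnorm mu D m)).
    by apply: ge_inf; [exact: (hA _ e0).2|exists m].
  by apply: HN; apply: sublevelW em; rewrite lerD2l.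
pose dd := sup E.
have dist_dd eps : 0 < eps <= 1 -> dist eps <= dd.
  by move=> e01; apply: ub_le_sup; [exact: hE.2|exists eps].
(* levels are close to i0 and norms to the limit dd of the minimal norms *)
have near_min rho : 0 < rho -> exists ep : R * (T -> C),
    [/\ 0 < ep.1 <= rho, sublevel (i0 + ep.1) ep.2,
        sqnorm mu D ep.2 <= dd + rho &
        forall m, sublevel (i0 + ep.1) m -> dd - rho <= sqnorm mu D m].
  move=> r0; have [_ [e1 /andP[e10 e11] ->] e1d] := sup_adherent r0 hE.
  pose e := Num.min e1 rho.
  have e0 : 0 < e by rewrite lt_min e10.
  have ee1 : e <= e1 by rewrite ge_min lexx.
  have erho : e <= rho by rewrite ge_min lexx orbT.
  have [_ [m em ->] md] := inf_adherent r0 (hA e e0).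
  exists (e, m); split => //=.
  - by rewrite e0.
  - rewrite (le_trans (ltW md))// lerD2r dist_dd// e0/=.
    exact: le_trans ee1 e11.
  - move=> m' em'; apply: ltW; apply: (lt_le_trans e1d).
    apply: ge_inf; first exact: (hA _ e10).2.
    by exists m' => //; apply: sublevelW em'; rewrite lerD2l.
have rho0 r : 0 < 8^-1 ^+ r :> R by rewrite exprn_gt0.
have /choice[ep epP] : forall r : nat, exists ep : R * (T -> C),
    [/\ 0 < ep.1 <= 8^-1 ^+ r, sublevel (i0 + ep.1) ep.2,
        sqnorm mu D ep.2 <= dd + 8^-1 ^+ r &
        forall m, sublevel (i0 + ep.1) m -> dd - 8^-1 ^+ r <= sqnorm mu D m].
  by move=> r; exact: near_min.
pose p r := (ep r).2.
have Lp r : in_L2 mu D (p r) by have [_ [L1 _] _ _] := epP r.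
have rhoS r : 8^-1 ^+ r.+1 <= 8^-1 ^+ r :> R.
  by rewrite exprS ler_piMl ?(ltW (rho0 r))// invf_le1// ler1n.
have step r : sqnorm mu D (fun x => p r.+1 x - p r x) <= 8 * 8^-1 ^+ r.
  have := @sqnorm_midpoint _ _ (Lp r) (Lp r.+1).
  have [/andP[e0 er] tp pd lo] := epP r.
  have [/andP[e0' er'] tp' pd' lo'] := epP r.+1.
  have : dd - 8^-1 ^+ r <= sqnorm mu D (fun x => (2^-1)%:C%C * (p r x + p r.+1 x)).
    have [ee|ee] := leP (ep r).1 (ep r.+1).1.
      apply: le_trans (lo' _ _); first by rewrite lerD2l lerN2.
      apply: sublevel_midpoint => //.
      by apply: sublevelW tp; rewrite lerD2l.
    apply: lo; apply: sublevel_midpoint => //.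
    by apply: sublevelW tp'; rewrite lerD2l ltW.
  by have := rhoS r; move: pd pd'; rewrite -/(p r) -/(p r.+1); lra.
have [q mq pq] := L2_fast_cauchy_ae_cvg mD Lp step.
have rho_cvg : 8^-1 ^+ r @[r --> \oo] --> (0 : R).
  by apply: cvg_expr; rewrite ger0_norm// invf_lt1// ltr1n.
have [Lq _] : in_L2 mu D q /\ sqnorm mu D q <= dd + 0.
  apply: (sqnorm_fatou mD Lp mq pq (B := fun r => dd + 8^-1 ^+ r)).
    by move=> r; have [] := epP r.
  by apply: cvgD => //; exact: cvg_cst.
exists i0, q; split => //; split => // v Sv.
have [_ qb] : in_L2 mu D (fun x => a v x - q x * b v x) /\
    sqnorm mu D (fun x => a v x - q x * b v x) <= 2 * (i0 + 0).
  apply: (@sqnorm_fatou _ _ _ _ _ mD (fun r x => a v x - p r x * b v x) _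
    (fun r => 2 * (i0 + 8^-1 ^+ r))).
  - by move=> r; exact: L2_residual.
  - exact: L2_cmeasurable (L2_residual Sv Lq).
  - exact: ae_cvg_affine.
  - move=> r; have [/andP[_ er] [_ /(_ v Sv) H] _ _] := epP r.
    rewrite -(@ler_pM2l _ 2^-1)// mulrA mulVf// mul1r.
    by apply: (le_trans H); rewrite lerD2l.
  - apply: cvgM; first exact: cvg_cst.
    by apply: cvgD => //; exact: cvg_cst.
by rewrite ler_pdivrMl// -[i0]addr0.
Qed.

End existence.

(** * Positive semidefinite matrices in real coordinates *)

Section psd_matrices.
Context {R : realType} {n : nat}.
Local Notation C := R[i].
Implicit Types (x y z : 'cV[C]_n) (A B : 'M[C]_n).

Lemma cdotDr x y z : cdot x (y + z) = cdot x y + cdot x z.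
Proof. by rewrite -big_split; apply: eq_bigr => k _; rewrite mxE mulrDr. Qed.

Lemma cdotZr a x y : cdot x (a *: y) = a * cdot x y.
Proof. by rewrite mulr_sumr; apply: eq_bigr => k _; rewrite mxE mulrCA. Qed.

Lemma cdotDl x y z : cdot (x + y) z = cdot x z + cdot y z.
Proof.
by rewrite -big_split; apply: eq_bigr => k _; rewrite mxE conjCD mulrDl.
Qed.

Lemma cdotZl a x y : cdot (a *: x) y = a^* * cdot x y.
Proof.
by rewrite mulr_sumr; apply: eq_bigr => k _; rewrite mxE conjCM mulrA.
Qed.

Lemma hermsymmxP A : reflect (forall k l, A k l = (A l k)^*) (A \is hermsymmx).
Proof.
apply: (iffP (is_hermitianmxP _ _ _)) => [AE k l|AE].
  by rewrite {1}AE expr0 scale1r !mxE.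
by apply/matrixP => k l; rewrite expr0 scale1r !mxE.
Qed.

Lemma hermsymmx_cdot A x y : A \is hermsymmx ->
  cdot x (A *m y) = cdot (A *m x) y.
Proof.
move/hermsymmxP => AE; rewrite /cdot.
under eq_bigr do rewrite mxE mulr_sumr.
under [RHS]eq_bigr do rewrite mxE conjC_sum mulr_suml.
rewrite exchange_big; apply: eq_bigr => k _; apply: eq_bigr => l _.
by rewrite conjCM -AE; ring.
Qed.

Lemma psd_convex A B (s : R) : 0 <= s <= 1 -> psd_hermitian A ->
  psd_hermitian B -> psd_hermitian ((1 - s)%:C%C *: A + s%:C%C *: B).
Proof.
move=> /andP[s0 s1] [/hermsymmxP hA pA] [/hermsymmxP hB pB]; split.
  apply/hermsymmxP => k l; rewrite !mxE conjCD !conjCM -hA -hB.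
  by rewrite !conjC_real.
move=> x; rewrite mulmxDl cdotDr -!scalemxAl !cdotZr addr_ge0// mulr_ge0//.
  by rewrite ler0c subr_ge0.
by rewrite ler0c.
Qed.

(** If A x were not 0, moving x slightly in the direction - A x would make the
    form negative: its first-order variation is - 2 |A x|^2. *)
Lemma psd_form_eq0 A x : psd_hermitian A ->
  cdot x (A *m x) = 0 -> A *m x = 0.
Proof.
move=> [hA pA] x0; set y := A *m x.
have yy0 : 0 <= cdot y y.
  by apply: sumr_ge0 => k _; rewrite mulrC -normCK exprn_ge0.
suff yy : cdot y y = 0.
  apply/colP => k; rewrite [RHS]mxE; move/eqP: yy; rewrite /cdot psumr_eq0; last first.
    by move=> i _; rewrite mulrC -normCK exprn_ge0.
  move/allP => /(_ k (mem_index_enum _)) /=; rewrite mulf_eq0 conjC_eq0 orbb.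
  by move/eqP.
pose c := complex.Re (cdot y y); pose q := complex.Re (cdot y (A *m y)).
have cE : cdot y y = c%:C%C by rewrite /c RRe_real// ger0_real.
have qE : cdot y (A *m y) = q%:C%C by rewrite /q RRe_real// ger0_real// pA.
have c0 : 0 <= c by rewrite -ler0c -cE.
have q0 : 0 <= q by rewrite -ler0c -qE pA.
(* the form at x - t y; the value of t used below is c / (c + q) *)
have H t : 0 <= - (2 * t * c) + t ^+ 2 * q.
  have := pA (x + (- t)%:C%C *: y).
  rewrite mulmxDr -scalemxAr !cdotDr !cdotDl !cdotZr !cdotZl -/y.
  rewrite (hermsymmx_cdot x y hA) -/y x0 cE qE conjC_real.
  rewrite -ler0c; congr (0 <= _).
  by apply/eqP; rewrite eq_complex/=; apply/andP; split; apply/eqP; ring.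
rewrite cE; congr (_%:C%C); apply/eqP; rewrite eq_le c0 andbT leNgt.
apply/negP => cgt0; have cq0 : 0 < c + q by rewrite ltr_wpDr.
have := H (c / (c + q)).
rewrite (_ : _ + _ = - ((c / (c + q)) ^+ 2 * (2 * c + q))); last first.
  field; exact: lt0r_neq0.
rewrite oppr_ge0 leNgt => /negP; apply.
by rewrite mulr_gt0// ?exprn_gt0 ?divr_gt0// ltr_wpDr// mulr_gt0.
Qed.

Local Notation Idx := ('I_n * 'I_n * bool)%type.

Definition cunit (b : bool) : C := if b then 'i%C else 1.

Definition pcoord (p : 'rV[R]_#|{: Idx}|) (a : Idx) : R := p ord0 (enum_rank a).

(** Matrices are parametrized by the real row vector of the real and imaginary
    parts of their entries: bounded closed sets of row vectors are compact, and
    the functionals to be maximized are real-linear or real-quadratic in these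
    coordinates. *)
Definition mx_of (p : 'rV[R]_#|{: Idx}|) : 'M[C]_n :=
  \matrix_(k, l) (pcoord p (k, l, false) +i* pcoord p (k, l, true))%C.

Definition coord_of (A : 'M[C]_n) : 'rV[R]_#|{: Idx}| :=
  \row_j (if (enum_val j).2 then @complex.Im R else @complex.Re R)
    (A (enum_val j).1.1 (enum_val j).1.2).

Lemma pcoord_of A a : pcoord (coord_of A) a =
  (if a.2 then @complex.Im R else @complex.Re R) (A a.1.1 a.1.2).
Proof. by rewrite /pcoord mxE enum_rankK. Qed.

Lemma coord_ofK A : mx_of (coord_of A) = A.
Proof.
apply/matrixP => k l; rewrite mxE !pcoord_of/=.
by case: (A k l).
Qed.

Lemma mx_of_convex p q (s : R) : mx_of ((1 - s) *: p + s *: q) =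
  (1 - s)%:C%C *: mx_of p + s%:C%C *: mx_of q.
Proof.
apply/matrixP => k l; rewrite !mxE /pcoord !mxE.
by apply/eqP; rewrite eq_complex/=; apply/andP; split; apply/eqP; ring.
Qed.

Lemma cdot_mx_of y z p : cdot y (mx_of p *m z) =
  \sum_a (pcoord p a)%:C%C *
    (cunit a.2 * ((y a.1.1 ord0)^* * z a.1.2 ord0)).
Proof.
transitivity (\sum_k \sum_l \sum_(b : bool) (pcoord p (k, l, b))%:C%C *
    (cunit b * ((y k ord0)^* * z l ord0))); last first.
  by rewrite !pair_bigA; apply: eq_bigr => -[[k l] b].
apply: eq_bigr => k _; rewrite mxE mulr_sumr; apply: eq_bigr => l _.
rewrite big_bool [mx_of p k l]complexE !mxE/=; ring.
Qed.

Lemma continuous_sum_mul (h : Idx -> 'rV[R]_#|{: Idx}| -> R) :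
  (forall a, continuous (h a)) ->
  continuous (fun p => \sum_a pcoord p a * h a p).
Proof.
move=> ch; elim: (index_enum _) => [|a s IH].
  by under [X in continuous X]eq_fun do rewrite big_nil; exact: cst_continuous.
under [X in continuous X]eq_fun do rewrite big_cons.
refine (fun p => @continuousD _ _ _ (fun q => pcoord q a * h a q) _ p _ (IH p)).
refine (@continuousM _ _ (fun q => pcoord q a) (h a) p _ (ch a p)).
exact: coord_continuous.
Qed.

Lemma continuous_sum_pcoord (r : Idx -> R) :
  continuous (fun p => \sum_a pcoord p a * r a).
Proof.
by apply: (continuous_sum_mul (h := fun a => cst (r a))) => a; exact: cst_continuous.
Qed.

Lemma Re_cdot_mx_of y z p : complex.Re (cdot y (mx_of p *m z)) =
  \sum_a pcoord p a *
    complex.Re (cunit a.2 * ((y a.1.1 ord0)^* * z a.1.2 ord0)).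
Proof.
rewrite cdot_mx_of cRe_sum.
apply: eq_bigr => a _; exact: cReZ.
Qed.

Lemma Im_cdot_mx_of y z p : complex.Im (cdot y (mx_of p *m z)) =
  \sum_a pcoord p a *
    complex.Im (cunit a.2 * ((y a.1.1 ord0)^* * z a.1.2 ord0)).
Proof.
rewrite cdot_mx_of cIm_sum.
apply: eq_bigr => a _; exact: cImZ.
Qed.

Lemma closed_ge0_continuous (T : topologicalType) (h : T -> R) :
  continuous h -> closed [set p | 0 <= h p].
Proof.
move=> ch; rewrite (_ : [set _ | _] = h @^-1` [set r | 0 <= r])//.
by apply: closed_comp; [move=> p _; exact: ch|exact: closed_ge].
Qed.

Lemma closed_eq_continuous (T : topologicalType) (g h : T -> R) :
  continuous g -> continuous h -> closed [set p | g p = h p].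
Proof.
move=> cg ch; rewrite (_ : [set _ | _] = (fun p => g p - h p) @^-1` [set 0]).
  apply: closed_comp; [|exact: closed_eq].
  by move=> p _; apply: cvgB; [exact: cg|exact: ch].
by apply/seteqP; split => p /= => [->|/eqP]; rewrite ?subrr// subr_eq0 => /eqP.
Qed.

Lemma closed_psd : closed [set p | psd_hermitian (mx_of p)].
Proof.
have cc (a : Idx) : continuous (fun p : 'rV[R]_#|{: Idx}| => pcoord p a).
  by move=> p; exact: coord_continuous.
rewrite (_ : [set _ | _] =
  \bigcap_(kl in [set: 'I_n * 'I_n])
     ([set p | pcoord p (kl, false) = pcoord p (kl.2, kl.1, false)] `&`
      [set p | pcoord p (kl, true) = - pcoord p (kl.2, kl.1, true)]) `&`
  \bigcap_(x in [set: 'cV[C]_n])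
     ([set p | complex.Im (cdot x (mx_of p *m x)) = 0] `&`
      [set p | 0 <= complex.Re (cdot x (mx_of p *m x))])).
  apply: closedI.
    apply: closed_bigI => kl _; apply: closedI.
      exact: closed_eq_continuous.
    apply: closed_eq_continuous => //.
    by refine (fun p => @continuousN _ _ _ (fun q => pcoord q _) p (cc _ p)).
  apply: closed_bigI => x _; apply: closedI.
    apply: closed_eq_continuous; last exact: cst_continuous.
    under [X in continuous X]eq_fun do rewrite Im_cdot_mx_of.
    exact: continuous_sum_pcoord.
  apply: closed_ge0_continuous.
  under [X in continuous X]eq_fun do rewrite Re_cdot_mx_of.
  exact: continuous_sum_pcoord.
apply/seteqP; split => p /=.
- move=> [/hermsymmxP hA pA]; split => [[k l] _|x _].
    by have := hA k l; rewrite !mxE => /eqP; rewrite eq_complex/= => /andP[/eqP-> /eqP->].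
  by have := pA x; rewrite lecE/= => /andP[/eqP-> ->].
- move=> [hA pA]; split.
    apply/hermsymmxP => k l; have [/= h1 h2] := hA (k, l) I.
    by apply/eqP; rewrite !mxE eq_complex/= h1 h2 !eqxx.
  by move=> x; rewrite lecE/=; have [-> ->] := pA x I; rewrite eqxx.
Qed.

End psd_matrices.

(** * Stationarity of an optimal multiplier *)

(** The passage from a second-order expansion along a segment to the first-order
    condition at its endpoint. *)
Lemma le0_of_le_small {R : realType} (X Y : R) :
  (forall s : R, 0 < s <= 1 -> X <= s * Y) -> X <= 0.
Proof.
move=> H; rewrite leNgt; apply/negP => X0.
have Y0 : 0 < Y by have := H 1; rewrite ltr01 lexx mul1r => /(_ isT); lra.
have /H : 0 < X / (X + Y) <= 1.
  by rewrite divr_gt0 ?addr_gt0//= ler_pdivrMr ?addr_gt0// mul1r; lra.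
rewrite mulrAC ler_pdivlMr ?addr_gt0// mulrDr gerDr.
by rewrite leNgt mulr_gt0.
Qed.

(** Here E0, E1 are the values of a linear functional and n0, n1, B the squared
    norms and the inner product of the images of a linear map, at the two ends
    of a segment; the hypothesis compares the concave function
    E - n / (2 L) at one end and at the point of parameter s. *)
Lemma concave_quadratic_step {R : realType} (E0 E1 n0 n1 B L s : R) :
  0 < s -> L != 0 ->
  (1 - s) * E0 + s * E1 - (2 * L)^-1 *
    ((1 - s) ^+ 2 * n0 + 2 * ((1 - s) * (s * B)) + s ^+ 2 * n1) <=
  E0 - (2 * L)^-1 * n0 ->
  E1 - E0 - L^-1 * (B - n0) <= s * ((2 * L)^-1 * (n0 - 2 * B + n1)).
Proof.
move=> s0 L0; rewrite -subr_ge0 => H; rewrite -subr_ge0 -(pmulr_rge0 _ s0).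
by rewrite [X in 0 <= X](_ : _ = E0 - (2 * L)^-1 * n0 - ((1 - s) * E0 + s * E1
  - (2 * L)^-1 * ((1 - s) ^+ 2 * n0 + 2 * ((1 - s) * (s * B)) + s ^+ 2 * n1)))//;
  field.
Qed.

Lemma convex_comb_le {R : realType} (s a b N : R) : 0 <= s <= 1 ->
  a <= N -> b <= N -> (1 - s) * a + s * b <= N.
Proof.
move=> /andP[s0 s1] aN bN; rewrite -subr_ge0.
rewrite (_ : _ - _ = (1 - s) * (N - a) + s * (N - b)); last by ring.
by rewrite addr_ge0// mulr_ge0// subr_ge0.
Qed.

Lemma abs2_sum_bounded {R : realType} (I : Type) (s : seq I) (b : R) :
  0 <= b -> exists2 L : R, 0 < L & forall z : I -> R[i],
    (forall i, abs2 (z i) <= b) -> abs2 (\sum_(i <- s) z i) <= L.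
Proof.
move=> b0; elim: s => [|i s [L L0 IH]].
  by exists 1 => // z _; rewrite big_nil abs20.
exists (2 * b + 2 * L) => [|z zb]; first by rewrite ltr_wpDl// ?mulr_ge0// mulr_gt0.
rewrite big_cons (le_trans (ler_abs2D _ _))//.
by apply: lerD; rewrite ler_pM2l//; exact: IH.
Qed.

Section stationarity.
Context {R : realType} {disp : measure_display} {T : measurableType disp}.
Variables (mu : {measure set T -> \bar R}) (D : set T).
Hypothesis mD : measurable D.
Variable n : nat.
Local Notation C := R[i].
Local Notation Idx := ('I_n * 'I_n * bool)%type.
Local Notation P := 'rV[R]_#|{: Idx}|.

Definition cvec (f : 'I_n -> T -> C) (x : T) : 'cV[C]_n := \col_i f i x.

(** The sum [lincomb] for functions on an arbitrary domain, to which it reduces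
    by conversion on row vectors. *)
Definition comb (c : 'rV[C]_n) (f : 'I_n -> T -> C) (x : T) : C :=
  \sum_(i < n) c ord0 i * f i x.

Definition rank1 (c : 'rV[C]_n) : 'M[C]_n :=
  \matrix_(k, l) ((c ord0 k)^* * c ord0 l).

Lemma cdot_rank1 c (f g : 'I_n -> T -> C) x :
  cdot (cvec f x) (rank1 c *m cvec g x) = (comb c f x)^* * comb c g x.
Proof.
rewrite /cdot /comb conjC_sum mulr_suml; apply: eq_bigr => k _.
rewrite !mxE !mulr_sumr; apply: eq_bigr => l _.
by rewrite !mxE conjCM; ring.
Qed.

Lemma rank1_psd c : psd_hermitian (rank1 c).
Proof.
split; first by apply/hermsymmxP => k l; rewrite !mxE conjCM conjCK mulrC.
move=> x.
have -> : cdot x (rank1 c *m x) =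
    (\sum_k c ord0 k * x k ord0)^* * (\sum_k c ord0 k * x k ord0).
  rewrite /cdot conjC_sum mulr_suml; apply: eq_bigr => k _.
  rewrite !mxE !mulr_sumr; apply: eq_bigr => l _.
  by rewrite !mxE conjCM; ring.
by rewrite mulrC -normCK exprn_ge0.
Qed.

Section form_integrals.
Variables (f w : 'I_n -> T -> C) (F : R).
Hypotheses (mf : forall i, cmeasurable D (f i))
  (fF : forall i x, D x -> abs2 (f i x) <= F)
  (Lw : forall i, in_L2 mu D (w i)).

(** For w = g - m f and the rank-one matrix of c this is minus the gradient, at
    the multiplier m, of half the integral of |comb c g - m comb c f|^2. *)
Definition gradient (p : P) (x : T) : C :=
  cdot (cvec f x) (mx_of p *m cvec w x).

Let pair_prod (a : Idx) (x : T) : C := cunit a.2 * ((f a.1.1 x)^* * w a.1.2 x).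

Let L2_pair_prod a : in_L2 mu D (pair_prod a).
Proof.
apply: L2Z => //; apply: (@L2_bounded_mul _ _ _ _ _ mD _ _ F) => //.
  exact: cmeasurableJ.
by move=> x Dx; rewrite abs2J fF.
Qed.

Lemma gradientE p x : gradient p x = \sum_a (pcoord p a)%:C%C * pair_prod a x.
Proof.
rewrite /gradient cdot_mx_of; apply: eq_bigr => a _.
by rewrite !mxE.
Qed.

Lemma L2_gradient p : in_L2 mu D (gradient p).
Proof.
rewrite (_ : gradient p = fun x => \sum_a (pcoord p a)%:C%C * pair_prod a x).
  by apply: L2_sum => // a; exact: L2Z.
by apply/funext => x; exact: gradientE.
Qed.

Lemma gradient_convex p q (s : R) x : gradient ((1 - s) *: p + s *: q) x =
  (1 - s)%:C%C * gradient p x + s%:C%C * gradient q x.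
Proof.
by rewrite /gradient mx_of_convex mulmxDl cdotDr -!scalemxAl !cdotZr.
Qed.

Lemma continuous_sqnorm_gradient : continuous (fun p => sqnorm mu D (gradient p)).
Proof.
have E p : sqnorm mu D (gradient p) = \sum_a pcoord p a *
    (\sum_b pcoord p b * inner mu D (pair_prod b) (pair_prod a)).
  rewrite -innerxx [in X in inner _ _ X _](_ : gradient p =
    fun x => \sum_a (pcoord p a)%:C%C * pair_prod a x); last first.
    by apply/funext => x; exact: gradientE.
  rewrite inner_suml//; last exact: L2_gradient.
  apply: eq_bigr => a _; congr (_ * _).
  rewrite innerC (_ : gradient p =
    fun x => \sum_a (pcoord p a)%:C%C * pair_prod a x); last first.
    by apply/funext => x; exact: gradientE.
  by rewrite inner_suml.
under [X in continuous X]eq_fun do rewrite E.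
by apply: continuous_sum_mul => a; exact: continuous_sum_pcoord.
Qed.

(** The linear extension to all matrices of the error of the linear combinations
    comb c, which are the values at rank-one matrices. *)
Definition quad_error (p : P) : R := 2^-1 *
  \int[mu]_(x in D) complex.Re (cdot (cvec w x) (mx_of p *m cvec w x)).

Let eta (a : Idx) : R :=
  2^-1 * inner mu D (fun x => (cunit a.2)^* * w a.1.1 x) (w a.1.2).

Lemma quad_errorE p : quad_error p = \sum_a pcoord p a * eta a.
Proof.
rewrite /quad_error.
transitivity (2^-1 * (\int[mu]_(x in D) \sum_a pcoord p a *
    rdot ((cunit a.2)^* * w a.1.1 x) (w a.1.2 x))).
  congr (_ * _); apply: eq_Rintegral => x _.
  rewrite Re_cdot_mx_of; apply: eq_bigr => a _.
  rewrite rdot_ReJ conjCM conjCK !mxE; congr (_ * complex.Re _); ring.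
transitivity (2^-1 * \sum_a pcoord p a *
    inner mu D (fun x => (cunit a.2)^* * w a.1.1 x) (w a.1.2)).
  congr (_ * _).
  have Lr (a : Idx) : mu.-integrable D
    (EFin \o (fun x => rdot ((cunit a.2)^* * w a.1.1 x) (w a.1.2 x))).
    by apply: integrable_rdot => //; exact: L2Z.
  rewrite Rintegral_sum//; last by move=> a; exact: integrable_RZ.
  by apply: eq_bigr => a _; rewrite RintegralZl.
by rewrite mulr_sumr; apply: eq_bigr => a _; rewrite mulrCA.
Qed.

Lemma continuous_quad_error : continuous quad_error.
Proof.
rewrite (_ : quad_error = fun p => \sum_a pcoord p a * eta a).
  exact: continuous_sum_pcoord.
by apply/funext => p; exact: quad_errorE.
Qed.

Lemma quad_error_convex p q (s : R) : quad_error ((1 - s) *: p + s *: q) =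
  (1 - s) * quad_error p + s * quad_error q.
Proof.
rewrite !quad_errorE !mulr_sumr -big_split; apply: eq_bigr => a _.
by rewrite /pcoord !mxE/=; ring.
Qed.

Lemma quad_error_rank1 c :
  quad_error (coord_of (rank1 c)) = 2^-1 * sqnorm mu D (comb c w).
Proof.
congr (_ * _); apply: eq_Rintegral => x _.
by rewrite coord_ofK cdot_rank1 -rdot_ReJ rdotxx.
Qed.

End form_integrals.

(** A minimax argument in which the dual problem is regularized. The quadratic
    penalty of weight 1 / (2 L) in the maximized function Phi makes one explicit
    competitor m', obtained by adding to m the function [gradient] of the
    maximizer divided by L, beat m unless this function vanishes. The convex hull of
    the rank-one matrices of K is never formed: Phi is maximized over all
    positive semidefinite matrices with bounded entries whose error is at
    most Es, a convex set which contains these rank-one matrices and is visibly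
    compact. *)
Lemma stationary_matrix (f g : 'I_n -> T -> C) (m : T -> C)
    (K : set 'rV[C]_n) (F M Es : R) :
  (forall i, cmeasurable D (f i)) ->
  (forall i x, D x -> abs2 (f i x) <= F) ->
  (forall i, in_L2 mu D (g i)) -> in_L2 mu D m ->
  0 <= F -> 0 <= M -> K !=set0 ->
  (forall c i, K c -> abs2 (c ord0 i) <= M) ->
  let w i x := g i x - m x * f i x in
  (forall c, K c -> 2^-1 * sqnorm mu D (comb c w) <= Es) ->
  (forall m' u, in_L2 mu D m' ->
    (forall c, K c ->
      2^-1 * sqnorm mu D (fun x => comb c g x - m' x * comb c f x) <= u) ->
    Es <= u) ->
  exists Sigma : 'M[C]_n, [/\ psd_hermitian Sigma,
    2^-1 * \int[mu]_(x in D)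
      complex.Re (cdot (cvec w x) (Sigma *m cvec w x)) = Es &
    {ae mu, forall x, D x -> cdot (cvec f x) (Sigma *m cvec w x) = 0}].
Proof.
move=> mf fF Lg Lm F0 M0 [c0 Kc0] KM w wEs opt.
have Lmf i : in_L2 mu D (fun x => m x * f i x).
  under [X in in_L2 _ _ X]eq_fun do rewrite mulrC.
  exact: (@L2_bounded_mul _ _ _ _ _ mD _ _ F (mf i) (fF i) Lm).
have Lw i : in_L2 mu D (w i) by exact: L2B.
have [L L0 HL] := abs2_sum_bounded (index_enum 'I_n) (mulr_ge0 M0 F0).
have cfL c x : K c -> D x -> abs2 (comb c f x) <= L.
  move=> Kc Dx; apply: HL => i; rewrite abs2M ler_pM ?abs2_ge0//.
    exact: KM.
  exact: fF.
pose N := M * M + 1.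
pose Q : set P := [set p | psd_hermitian (mx_of p)] `&`
  [set p : P | forall j, `[- N, N]%classic (p ord0 j)] `&`
  [set p | 0 <= Es - quad_error w p].
have cQ : compact Q.
  have cbox : compact [set p : P | forall j, `[- N, N]%classic (p ord0 j)].
    by apply: (@rV_compact _ _ (fun=> `[- N, N]%classic)) => _; exact: segment_compact.
  apply: (subclosed_compact _ cbox); last by move=> p [[]].
  apply: closedI; last first.
    apply: closed_ge0_continuous.
    refine (fun p => @continuousB _ _ _ (cst Es) (quad_error w) p _ _).
      exact: cst_continuous.
    exact: continuous_quad_error.
  apply: closedI; first exact: closed_psd.
  apply: compact_closed => //.
have Qrank1 c : K c -> Q (coord_of (rank1 c)).
  move=> Kc; split; [split|].
  - by rewrite /= coord_ofK; exact: rank1_psd.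
  - move=> j /=; rewrite in_itv/= -ler_norml mxE.
    set z := rank1 _ _ _.
    have zN : abs2 z <= M * M.
      by rewrite /z mxE abs2M abs2J ler_pM ?abs2_ge0//; exact: KM.
    have aux (a b : R) : a ^+ 2 + b ^+ 2 <= M * M -> `|a| <= N.
      move=> ab; have := sqr_ge0 (a - 1); have := sqr_ge0 (a + 1).
      have := sqr_ge0 a; have := sqr_ge0 b.
      by rewrite ler_norml /N !expr2 in ab *; move=> *; apply/andP; split; nra.
    by case: (enum_val j).2; [apply: (aux _ (complex.Re z)); rewrite addrC|
      apply: (aux _ (complex.Im z))].
  - by rewrite /= quad_error_rank1 subr_ge0; exact: wEs.
have LG p : in_L2 mu D (gradient f w p) by exact: (L2_gradient mf fF Lw).
pose Phi p := quad_error w p - (2 * L)^-1 * sqnorm mu D (gradient f w p).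
have Q0 : Q !=set0 by exists (coord_of (rank1 c0)); exact: Qrank1.
have [|p0 /set_mem Qp0 p0max] := @compact_EVT_max _ _ Phi Q Q0 cQ.
  apply: continuous_subspaceT.
  refine (fun p => @continuousB _ _ _ (quad_error w)
    (fun p => (2 * L)^-1 * sqnorm mu D (gradient f w p)) p _ _).
    exact: continuous_quad_error.
  refine (@continuousM _ _ (cst (2 * L)^-1)
    (fun p => sqnorm mu D (gradient f w p)) p _ _).
    exact: cst_continuous.
  exact: (continuous_sqnorm_gradient mf fF Lw).
pose n0 := sqnorm mu D (gradient f w p0).
have first_order q : Q q -> quad_error w q - quad_error w p0 -
    L^-1 * (inner mu D (gradient f w q) (gradient f w p0) - n0) <= 0.
  move=> Qq; pose B := inner mu D (gradient f w q) (gradient f w p0).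
  pose n1 := sqnorm mu D (gradient f w q).
  apply: (@le0_of_le_small _ _ ((2 * L)^-1 * (n0 - 2 * B + n1))).
  move=> s /andP[s0 s1]; have s01 : 0 <= s <= 1 by rewrite (ltW s0).
  have Qs : Q ((1 - s) *: p0 + s *: q).
    case: Qp0 Qq => -[psd0 box0] /= E0 [[psdq boxq] /= Eq]; split; [split|].
    - by rewrite /= mx_of_convex; exact: psd_convex s01 psd0 psdq.
    - move=> j /=; have := box0 j; have := boxq j.
      rewrite !mxE /= !in_itv/= => /andP[a1 a2] /andP[a3 a4].
      rewrite convex_comb_le// andbT lerNl opprD -!mulrN.
      by apply: convex_comb_le => //; rewrite lerNl.
    - rewrite /= quad_error_convex// subr_ge0.
      rewrite subr_ge0 in E0; rewrite subr_ge0 in Eq.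
      exact: convex_comb_le s01 E0 Eq.
  have := p0max _ (mem_set Qs).
  rewrite /Phi quad_error_convex//.
  have -> : sqnorm mu D (gradient f w ((1 - s) *: p0 + s *: q)) =
      (1 - s) ^+ 2 * n0 + 2 * ((1 - s) * (s * B)) + s ^+ 2 * n1.
    rewrite (_ : gradient f w _ = fun x => (1 - s)%:C%C * gradient f w p0 x +
      s%:C%C * gradient f w q x); last first.
      by apply/funext => x; exact: gradient_convex.
    rewrite sqnormD//; [|exact: L2Z..].
    rewrite !sqnormZ// innerZl//; last exact: L2Z.
    by rewrite innerC innerZl.
  by apply: concave_quadratic_step; rewrite ?gt_eqF.
(* the competitor that first_order shows to be better than m *)
pose m' x := m x + (L^-1)%:C%C * gradient f w p0 x.
have Lm' : in_L2 mu D m' by apply: L2D => //; exact: L2Z.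
have EsE : Es <= quad_error w p0 - (2 * L)^-1 * n0.
  apply: (opt m' _ Lm') => c Kc.
  have mc : cmeasurable D (comb c f).
    by apply: cmeasurable_sum => // i; apply: cmeasurableM => //; exact: cmeasurable_cst.
  have Lcw : in_L2 mu D (comb c w) by apply: L2_sum => // i; exact: L2Z.
  have LGf : in_L2 mu D (fun x => comb c f x * gradient f w p0 x).
    by apply: (@L2_bounded_mul _ _ _ _ _ mD _ _ L) => // x Dx; exact: cfL.
  rewrite (_ : (fun x => _) = fun x => comb c w x +
    (- L^-1)%:C%C * (comb c f x * gradient f w p0 x)); last first.
    apply/funext => x.
    have -> : comb c w x = comb c g x - m x * comb c f x.
      rewrite /comb mulr_sumr -sumrB; apply: eq_bigr => i _.
      by rewrite /w; ring.
    by rewrite /m' (_ : (- L^-1)%:C%C = - (L^-1)%:C%C) ?rmorphN//; ring.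
  rewrite sqnormD//; last exact: L2Z.
  rewrite innerC innerZl// sqnormZ//.
  have -> : inner mu D (fun x => comb c f x * gradient f w p0 x) (comb c w) =
      inner mu D (gradient f w (coord_of (rank1 c))) (gradient f w p0).
    apply: eq_Rintegral => x _; rewrite rdotC !rdot_ReJ /gradient coord_ofK.
    by rewrite cdot_rank1 conjCM conjCK; congr complex.Re; ring.
  have := first_order _ (Qrank1 _ Kc).
  rewrite quad_error_rank1.
  set B := inner _ _ _ _; set e := sqnorm mu D (comb c w).
  have : sqnorm mu D (fun x => comb c f x * gradient f w p0 x) <= L * n0.
    apply: le_sqnorm => // x Dx.
    by rewrite abs2M ler_wpM2r ?abs2_ge0//; exact: cfL.
  set h := sqnorm _ _ _ => hL fo.
  have h2 : L^-1 ^+ 2 * h <= L^-1 * n0.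
    rewrite expr2 -mulrA ler_pM2l ?invr_gt0// -(ler_pM2l L0) mulrA.
    by rewrite mulfV ?gt_eqF// mul1r.
  rewrite invfM; lra.
have E0Es : quad_error w p0 <= Es by case: Qp0 => _ /=; rewrite subr_ge0.
have n00 : 0 <= n0 by exact: sqnorm_ge0.
have n0E : n0 = 0.
  apply/eqP; rewrite eq_le n00 andbT -(@pmulr_rle0 _ (2 * L)^-1).
    by lra.
  by rewrite invr_gt0 mulr_gt0.
exists (mx_of p0); split.
- by case: Qp0 => -[].
- by apply/eqP; rewrite eq_le E0Es; move: EsE; rewrite n0E mulr0 subr0.
- exact: (sqnorm_eq0 mD (LG p0) n0E).
Qed.

End stationarity.

(** * Zeros of functions whose derivatives are uniformly bounded *)

Section bounded_jets.
Context {R : realType}.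
Implicit Types (g : R -> R) (h : nat -> R -> R).

Lemma lipschitz_of_derive (f df : R -> R) (a b L : R) :
  (forall x : R, is_derive x 1 f (df x)) ->
  (forall x, `|x - a| <= `|b - a| -> `|df x| <= L) ->
  `|f b - f a| <= L * `|b - a|.
Proof.
move=> fdf dfL.
have cf (x y : R) : {within `[x, y], continuous f}.
  by apply: derivable_within_continuous => z _; have [] := fdf z.
have [ab|/ltW ba] := leP a b.
  have [c cab ->] := @MVT_segment _ f df a b ab (fun x _ => fdf x) (cf a b).
  rewrite normrM ler_wpM2r// dfL//.
  by move: cab; rewrite in_itv/= => /andP[ac cb]; rewrite !ger0_norm ?subr_ge0// lerD2r.
have [c cab fE] := @MVT_segment _ f df b a ba (fun x _ => fdf x) (cf b a).
rewrite distrC fE normrM distrC ler_wpM2r// dfL//.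
move: cab; rewrite in_itv/= => /andP[bc ca].
by rewrite !(distrC _ a) !ger0_norm ?subr_ge0// lerD2l lerN2.
Qed.

Definition bounded_jet h (M : R) : Prop :=
  (forall k (x : R), is_derive x 1 (h k) (h k.+1 x)) /\
  (forall k x, `|h k x| <= M).

(** One constant bounds the derivatives of all orders, as it does for Fourier
    transforms of functions supported in the unit cube. This is much stronger
    than analyticity and lets iterated mean value estimates replace power
    series. *)
Definition has_bounded_jet g : Prop :=
  exists h M, bounded_jet h M /\ h 0%N = g.

Lemma bounded_jetD g1 g2 : has_bounded_jet g1 -> has_bounded_jet g2 ->
  has_bounded_jet (fun x => g1 x + g2 x).
Proof.
move=> [h1 [M1 [[d1 b1] <-]]] [h2 [M2 [[d2 b2] <-]]].
exists (fun k x => h1 k x + h2 k x), (M1 + M2); split => //; split => k x.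
  by apply: is_deriveD.
by rewrite (le_trans (ler_normD _ _))// lerD.
Qed.

Lemma bounded_jetZ (r : R) g : has_bounded_jet g ->
  has_bounded_jet (fun x => r * g x).
Proof.
move=> [h [M [[dh bh] <-]]].
exists (fun k x => r * h k x), (`|r| * M); split => //; split => k x.
  by apply: is_deriveZ.
by rewrite normrM ler_wpM2l.
Qed.

Section vanishing.
Variables (h : nat -> R -> R) (M : R).
Hypothesis jh : bounded_jet h M.

Let vanish_half t0 t : (forall k, h k t0 = 0) -> `|t - t0| <= 2^-1 ->
  forall k, h k t = 0.
Proof.
move=> h0 tt0.
have bound j : forall k s, `|s - t0| <= 2^-1 -> `|h k s| <= M * 2^-1 ^+ j.
  elim: j => [|j IH] k s ss0; first by rewrite expr0 mulr1; exact: jh.2.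
  have : `|h k s - h k t0| <= M * 2^-1 ^+ j * `|s - t0|.
    apply: (@lipschitz_of_derive (h k) (h k.+1)); first exact: jh.1.
    by move=> x xs; apply: IH; exact: le_trans ss0.
  rewrite h0 subr0 => /le_trans; apply.
  rewrite exprSr mulrA ler_wpM2l// mulr_ge0 ?exprn_ge0//.
  exact: le_trans (normr_ge0 _) (jh.2 0%N 0).
move=> k; apply/eqP; rewrite -normr_le0.
have cv : M * 2^-1 ^+ j @[j --> \oo] --> M * 0.
  by apply: cvgM; [exact: cvg_cst|apply: cvg_expr; rewrite ger0_norm// invf_lt1// ltr1n].
rewrite -(mulr0 M) -(cvg_lim _ cv)//; apply: limr_ge.
  by apply/cvg_ex; exists (M * 0).
by apply: nearW => j; exact: bound.
Qed.

(** Iterating the mean value inequality j times at distance at most 1/2 of t0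
    gives the bound M / 2^j, so h vanishes near t0 to all orders; steps of
    length 1/2 then reach every point. *)
Lemma jet_vanish t0 : (forall k, h k t0 = 0) -> forall k t, h k t = 0.
Proof.
move=> h0.
have H N : forall t, `|t - t0| <= N%:R / 2 -> forall k, h k t = 0.
  elim: N => [|N IH] t tt0.
    by apply: (vanish_half h0); rewrite (le_trans tt0)// mul0r invr_ge0.
  pose t1 := t0 + (t - t0) * (N%:R / N.+1%:R).
  have N0 : 0 < N.+1%:R :> R by rewrite ltr0n.
  have h1 : forall k, h k t1 = 0.
    apply: IH; rewrite /t1 addrC addKr normrM (@ger0_norm _ (_ / _))//.
    rewrite mulrA ler_pdivrMr// (le_trans (ler_wpM2r _ tt0))//.
    by rewrite mulrAC (mulrC N.+1%:R) mulrAC.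
  apply: (vanish_half h1).
  have -> : t - t1 = (t - t0) / N.+1%:R.
    by rewrite /t1 -natr1; field; rewrite natr1 gt_eqF.
  rewrite normrM normfV (@ger0_norm _ N.+1%:R)// ler_pdivrMr//.
  by rewrite mulrC.
move=> k t; apply: (H (Num.truncn (`|t - t0| * 2)).+1).
by rewrite ler_pdivlMr// ltW// truncnS_gt.
Qed.

(** By [jet_vanish] some derivative is nonzero at every zero t of h 0. If h k.+1 is
    the first one, then t is an isolated zero of h k, and a set of reals has
    countably many isolated points. *)
Lemma countable_zeros t1 : h 0%N t1 != 0 -> countable [set t | h 0%N t = 0].
Proof.
move=> ht1.
have nonflat t : exists k, h k t != 0.
  apply/not_existsP => H; move/eqP: ht1; apply; apply: (jet_vanish (t0 := t)).
  by move=> k; have /negP/negPn/eqP := H k.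
apply: (@sub_countable _ _ _ (\bigcup_k isolated [set t | h k t = 0])); last first.
  by apply: bigcup_countable => // k _; exact: countable_isolated.
apply: subset_card_le => t /= ht.
case: (ex_minnP (nonflat t)) => -[|k]; first by rewrite ht eqxx.
move=> hkt kmin; exists k => //; split.
  by rewrite inE/=; apply/eqP; apply/negPn/negP => /kmin; rewrite ltnn.
have hk0 : h k t = 0 by apply/eqP; apply/negPn/negP => /kmin; rewrite ltnn.
have [/cvg_ex[/= l hl] hE] := jh.1 k t.
have lE : l = h k.+1 t by rewrite -hE; apply/esym/cvg_lim.
have : \forall s \near 0^', s^-1 *: ((h k \o shift t) (s *: 1) - h k t) != 0.
  move/cvgr_neq0 : hl => /(_ _); apply.
  by rewrite lE.
rewrite near_withinE => -[e /= e0 He].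
exists (ball t e); first exact: nbhsx_ballx.
apply/seteqP; split => [s [/= ts hs]|s ->]; last by split; [exact: ballxx|].
apply/eqP/negPn/negP => st.
have := He (s - t); rewrite /ball_/= sub0r normrN distrC subr_eq0 => /(_ ts st).
by rewrite [_%:A]mulr1 subrK hs hk0 subrr scaler0 eqxx.
Qed.

End vanishing.
End bounded_jets.

(** * Zero sets in several variables are Lebesgue-null *)

Section zero_sets.
Context {R : realType}.

(** Regularity is required along coordinate lines only: this passes to slices
    without any computation, as the induction on the dimension requires. *)
Definition coordwise_jet (d : nat) (h : 'rV[R]_d -> R) : Prop :=
  measurable_fun setT h /\
  forall x j, has_bounded_jet (fun t => h (x + t *: delta_mx ord0 j)).

Lemma coordwise_jetD d (h1 h2 : 'rV[R]_d -> R) :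
  coordwise_jet h1 -> coordwise_jet h2 ->
  coordwise_jet (fun x => h1 x + h2 x).
Proof.
move=> [m1 j1] [m2 j2]; split; first exact: measurable_funD.
by move=> x j; exact: bounded_jetD.
Qed.

Lemma coordwise_jetZ d (r : R) (h : 'rV[R]_d -> R) :
  coordwise_jet h -> coordwise_jet (fun x => r * h x).
Proof.
move=> [m1 j1]; split; first exact: measurable_funM.
by move=> x j; exact: bounded_jetZ.
Qed.

Lemma cons_rV_shift d (a t : R) (x : 'rV[R]_d) :
  cons_rV (a, x) + t *: delta_mx ord0 ord0 = cons_rV (a + t, x).
Proof.
apply/rowP => i; rewrite !mxE eqxx/=.
case: unliftP => [k ->|->]; first by rewrite mulr0 addr0.
by rewrite mulr1.
Qed.

Lemma cons_rV_shift_lift d (a t : R) (x : 'rV[R]_d) (j : 'I_d) :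
  cons_rV (a, x) + t *: delta_mx ord0 (lift ord0 j) =
  cons_rV (a, x + t *: delta_mx ord0 j).
Proof.
apply/rowP => i; rewrite !mxE eqxx/=.
case: unliftP => [k ->|->]; last by rewrite mulr0 addr0.
by rewrite !mxE (inj_eq lift_inj).
Qed.

Lemma cons_rV_uncons d (y : 'rV[R]_d.+1) :
  cons_rV (y ord0 ord0, \row_j y ord0 (lift ord0 j)) = y.
Proof.
apply/rowP => i; rewrite !mxE.
by case: unliftP => [k ->|->]; rewrite ?mxE.
Qed.

Lemma coordwise_jet_slice d (h : 'rV[R]_d.+1 -> R) (a : R) :
  coordwise_jet h -> coordwise_jet (fun x => h (cons_rV (a, x))).
Proof.
move=> [mh jh]; split.
  apply: measurableT_comp => //.
  apply: (measurableT_comp (@measurable_cons_rV R d)).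
  exact: measurable_pair1.
move=> x j; have [H [M [bH HE]]] := jh (cons_rV (a, x)) (lift ord0 j).
exists H, M; split => //; rewrite HE; apply/funext => t.
by rewrite cons_rV_shift_lift.
Qed.

Lemma measurable_zeros d (h : 'rV[R]_d -> R) : measurable_fun setT h ->
  measurable [set x | h x = 0].
Proof.
move=> mh; rewrite (_ : [set _ | _] = setT `&` h @^-1` [set 0]).
  by apply: mh.
by rewrite setTI.
Qed.

(** Slice by the first coordinate a. By induction the slice of the zero set is
    null, unless h vanishes on the whole hyperplane of first coordinate a; then
    a is a zero of the restriction of h to the line through x0 in the first
    direction, and these a are countably many. *)
Lemma lebesgue_zeros d (h : 'rV[R]_d -> R) x0 :
  coordwise_jet h -> h x0 != 0 -> lebesgue_rV R d [set x | h x = 0] = 0.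
Proof.
elim: d h x0 => [|d IH] h x0 jh hx0.
  rewrite /= diracE memNset// => /= h0; move/eqP: hx0; apply.
  by rewrite -h0; congr h; apply/rowP => -[].
have mZ := measurable_zeros jh.1.
pose a0 := x0 ord0 ord0; pose y0 := \row_j x0 ord0 (lift ord0 j).
have hay0 : h (cons_rV (a0, y0)) != 0 by rewrite cons_rV_uncons.
pose N : set (measurableTypeR R) := [set a | h (cons_rV (a, y0)) = 0].
have mhy : measurable_fun setT (fun a : measurableTypeR R => h (cons_rV (a, y0))).
  apply: measurableT_comp; first exact: jh.1.
  apply: (measurableT_comp (@measurable_cons_rV R d)).
  exact: measurable_pair2.
have mN : measurable N.
  rewrite (_ : N = setT `&` (fun a => h (cons_rV (a, y0))) @^-1` [set 0]).
    by apply: mhy.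
  by rewrite setTI.
have N0 : @lebesgue_measure R N = 0.
  apply: countable_lebesgue_measure0.
  have [H [M [bH HE]]] := jh.2 (cons_rV (0, y0)) ord0.
  have HE' t : H 0%N t = h (cons_rV (t, y0)).
    by rewrite HE cons_rV_shift add0r.
  rewrite (_ : N = [set t | H 0%N t = 0]).
    by apply: (countable_zeros bH (t1 := a0)); rewrite HE'.
  by apply/funext => t; rewrite /N/= HE'.
pose A := @cons_rV R d @^-1` [set x | h x = 0].
transitivity (\int[@lebesgue_measure R]_a
   (lebesgue_rV R d \o xsection A) a)%E.
  by [].
rewrite (@ge0_negligible_integral _ _ _ _ setT N)//; last first.
  apply: measurable_fun_xsection; rewrite -[X in measurable X]setTI.
  exact: measurable_cons_rV.
rewrite integral0_eq// => a [_ aN] /=.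
rewrite (_ : xsection A a = [set x | h (cons_rV (a, x)) = 0]).
  apply: (IH _ y0); first exact: coordwise_jet_slice.
  by apply/eqP => ha; apply: aN.
by apply/seteqP; split => x; rewrite /xsection/= inE.
Qed.

End zero_sets.

(** * Fourier transforms of functions supported in the unit cube *)

Section cosine_integrals.
Context {R : realType} {disp : measure_display} {T : measurableType disp}.
Variables (mu : {measure set T -> \bar R}) (D : set T).
Hypothesis mD : measurable D.
Variables (p : T -> R).
Hypotheses (int_p : mu.-integrable D (EFin \o p)).

Lemma integrable_mul_bounded (b : T -> R) : measurable_fun D b ->
  (forall x, D x -> `|b x| <= 1) ->
  mu.-integrable D (EFin \o (fun x => p x * b x)).
Proof.
move=> mb b1; have mp : measurable_fun D p.
  by apply/measurable_EFinP; exact: measurable_int int_p.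
apply: le_integrable int_p => //.
  by apply/measurable_EFinP; exact: measurable_funM.
by move=> x Dx /=; rewrite lee_fin normrM ler_piMr// b1.
Qed.

Lemma measurable_cos (s : T -> R) : measurable_fun D s ->
  measurable_fun D (fun x => cos (s x)).
Proof.
move=> ms; apply: measurableT_comp => //.
by apply: continuous_measurable_fun; exact: continuous_cos.
Qed.

Variables (y A : T -> R).
Hypotheses (my : measurable_fun D y) (mA : measurable_fun D A).
Hypothesis y1 : forall x, D x -> `|y x| <= 1.

Lemma cosine_integral_jet :
  has_bounded_jet (fun t => \int[mu]_(x in D) (p x * cos (A x - t * y x))).
Proof.
(* each derivative in t brings down a factor y and shifts the phase by pi/2 *)
pose F k t x := p x * (y x ^+ k * cos (A x - t * y x - k%:R * (pi / 2))).
have mF k t : measurable_fun D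
    (fun x => y x ^+ k * cos (A x - t * y x - k%:R * (pi / 2))).
  apply: measurable_funM; first exact: measurable_funX.
  apply: measurable_cos; apply: measurable_funB => //.
  by apply: measurable_funB => //; exact: measurable_funM.
have bF k t x : D x -> `|y x ^+ k * cos (A x - t * y x - k%:R * (pi / 2))| <= 1.
  move=> Dx; rewrite normrM normrX mulr_ile1 ?exprn_ge0 ?cos_max//.
  by rewrite exprn_ile1// y1.
have iF k t : mu.-integrable D (EFin \o F k t).
  by apply: integrable_mul_bounded => // x Dx; exact: bF.
have dF k (t : R) x : is_derive t 1 (F k ^~ x) (F k.+1 t x).
  have -> : F k.+1 t x = p x * (y x ^+ k *
     (- sin (A x - t * y x - k%:R * (pi / 2)) * (- y x))).
    rewrite /F -natr1 mulrDl mul1r opprD addrA cosBpihalf exprSr.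
    by ring.
  rewrite /F; apply: is_deriveZ; apply: is_deriveZ.
  apply: is_derive1_comp.
  have := is_deriveB (is_derive_cst (A x - k%:R * (pi / 2) : R) t 1)
    (is_deriveZ (y x) (is_derive_id t (1 : R))).
  rewrite (_ : cst _ - _ =
      fun s : R => A x - s * y x - k%:R * (pi / 2)); last first.
    apply/funext => s; rewrite !fctE /=.
    have -> : y x *: s = y x * s by [].
    ring.
  move/is_derive_eq; apply.
  by have -> : y x *: (1 : R) = y x * 1 by []; ring.
exists (fun k t => \int[mu]_(x in D) F k t x), (\int[mu]_(x in D) `|p x|).
split; last first.
  by apply/funext => t; apply: eq_Rintegral => x _; rewrite /F expr0 mul1r mul0r subr0.
split => k t; last first.
  apply: (le_trans (le_normr_Rintegral mD (iF k t))).
  apply: le_Rintegral => //.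
  - exact: (integrable_norm (iF k t)).
  - exact: integrable_norm.
  - by move=> x Dx; rewrite normrM ler_piMr// bF.
have It : `]t - 1, t + 1[%classic t.
  by rewrite /= in_itv/=; apply/andP; split; lra.
have d1 s x : partial1of2 (F k) s x = F k.+1 s x.
  by rewrite partial1of2E; have [] := dF k s x.
have der s x : derivable (F k ^~ x) s 1 by have [] := dF k s x.
have H1 s x : `]t - 1, t + 1[%classic s -> D x -> derivable (F k ^~ x) s 1.
  by [].
have H2 s x : `]t - 1, t + 1[%classic s -> D x -> `|partial1of2 (F k) s x| <= `|p x|.
  by move=> _ Dx; rewrite d1 /F normrM ler_piMr// bF.
have Hi s : `]t - 1, t + 1[%classic s -> mu.-integrable D (EFin \o F k s) by [].
have int_normp : mu.-integrable D (EFin \o (fun x => `|p x|)) by exact: integrable_norm.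
apply: DeriveDef.
  exact: (derivable_under_integral mD It Hi H1 (fun x => normr_ge0 (p x)) int_normp H2).
rewrite -derive1E.
rewrite (differentiation_under_integral mD It Hi H1 (fun x => normr_ge0 (p x)) int_normp H2).
by apply: eq_Rintegral => x _; rewrite d1.
Qed.

End cosine_integrals.

Section fourier_regularity.
Context {R : realType} {d : nat}.
Local Notation leb := (lebesgue_rV R d).
Local Notation cube := (@unit_cube R d).

Lemma continuous_measurable_rV (h : 'rV[R]_d -> R) : continuous h ->
  measurable_fun setT h.
Proof.
move=> ch; apply: (measurability _ (RGenOpens.measurableE R)).
move=> _ [_ [a [b ->]] <-]; rewrite setTI; apply: open_measurable_rV.
by apply: open_comp; [move=> x _; exact: ch|exact: interval_open].
Qed.

Lemma measurable_unit_cube : measurable cube.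
Proof.
rewrite (_ : cube = \bigcap_(j in [set: 'I_d])
    ((fun x : 'rV[R]_d => x ord0 j) @^-1` `[0, 1])).
  apply: fin_bigcap_measurable => // j _; rewrite -[X in measurable X]setTI.
  exact: measurable_coord.
apply/seteqP; split => x /= H j; first by move=> _; rewrite /= in_itv/=; exact: H.
by have := H j I; rewrite /= in_itv.
Qed.

Lemma lebesgue_unit_cube : leb cube = 1%E.
Proof.
have := @lebesgue_rV_box R d (fun=> 0) (fun=> 1) (fun=> ler01).
under eq_bigr do rewrite subr0; by rewrite big1// => <-.
Qed.

Definition pairing (x xi : 'rV[R]_d) : R := \sum_(j < d) x ord0 j * xi ord0 j.

Lemma measurable_pairing xi (D : set 'rV[R]_d) :
  measurable_fun D (fun x => pairing x xi).
Proof.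
apply: measurable_funS (measurableT) (subsetT _) _.
rewrite /pairing; elim: (index_enum _) => [|j s IH].
  by under eq_fun do rewrite big_nil; exact: measurable_cst.
under eq_fun do rewrite big_cons.
apply: measurable_funD => //; apply: measurable_funM => //.
exact: measurable_coord.
Qed.

Variables (p : 'rV[R]_d -> R) (phi : R).
Hypothesis int_p : leb.-integrable cube (EFin \o p).

(** With phases 0 and - pi / 2 these give the real and imaginary parts of Fourier
    transforms, sines being cosines with a shifted phase. *)
Definition cosine_transform (xi : 'rV[R]_d) : R :=
  \int[leb]_(x in cube) (p x * cos (phi - pairing x xi)).

Let mcube := measurable_unit_cube.

Let icos xi :
  leb.-integrable cube (EFin \o (fun x => p x * cos (phi - pairing x xi))).
Proof.
apply: integrable_mul_bounded => //; last by move=> x _; exact: cos_max.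
by apply: measurable_cos; apply: measurable_funB => //; exact: measurable_pairing.
Qed.

Lemma cos_lipschitz (a b : R) : `|cos b - cos a| <= `|b - a|.
Proof.
rewrite -[leRHS]mul1r.
apply: (@lipschitz_of_derive _ _ (fun x => - sin x)) => x _.
by rewrite normrN sin_max.
Qed.

Lemma cosine_transform_lipschitz xi eta :
  `|cosine_transform xi - cosine_transform eta| <=
  (\int[leb]_(x in cube) `|p x|) * \sum_(j < d) `|xi ord0 j - eta ord0 j|.
Proof.
rewrite /cosine_transform -RintegralB//.
have iB : leb.-integrable cube (EFin \o (fun x =>
    p x * cos (phi - pairing x xi) - p x * cos (phi - pairing x eta))).
  exact: integrable_RB.
apply: (le_trans (le_normr_Rintegral mcube iB)).
rewrite -RintegralZr//; last exact: integrable_norm.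
apply: le_Rintegral => //.
- exact: (integrable_norm iB).
- rewrite (_ : (fun x => _) = fun x =>
      (\sum_(j < d) `|xi ord0 j - eta ord0 j|) * `|p x|).
    by apply: integrable_RZ => //; exact: integrable_norm.
  by apply/funext => x; rewrite mulrC.
move=> x xc; rewrite -mulrBr normrM ler_wpM2l//.
apply: (le_trans (cos_lipschitz _ _)).
rewrite (_ : _ - _ = \sum_(j < d) x ord0 j * (eta ord0 j - xi ord0 j)).
  apply: (le_trans (ler_norm_sum _ _ _)); apply: ler_sum => j _.
  rewrite normrM distrC ler_piMl// ger0_norm; by have /andP[] := xc j.
rewrite (_ : _ - _ = pairing x eta - pairing x xi); last by ring.
by rewrite /pairing -sumrB; apply: eq_bigr => j _; rewrite mulrBr.
Qed.

Lemma continuous_cosine_transform : continuous cosine_transform.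
Proof.
move=> xi; apply/(@cvgrPdist_lt _ _ _ (nbhs xi) (nbhs_filter xi)) => e e0.
set P := \int[leb]_(x in cube) `|p x|.
have P0 : 0 <= P by apply: Rintegral_ge0.
have K0 : 0 < P * d%:R + 1 by rewrite ltr_wpDl// mulr_ge0.
have dl0 : 0 < e / (P * d%:R + 1) by rewrite divr_gt0.
near=> eta.
have near_eta : ball xi (e / (P * d%:R + 1)) eta.
  by near: eta; exact: nbhsx_ballx.
apply: (le_lt_trans (cosine_transform_lipschitz xi eta)); rewrite -/P.
apply: (@le_lt_trans _ _ (P * (d%:R * (e / (P * d%:R + 1))))).
  rewrite ler_wpM2l// (le_trans (ler_sum (G := fun=> e / (P * d%:R + 1)) _ _))//.
    by move=> j _; apply: ltW; have [_] := near_eta; apply.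
  by rewrite sumr_const card_ord mulr_natl.
by rewrite !mulrA ltr_pdivrMr// (mulrC e) ltr_pM2r// ltrDl.
Unshelve. all: by end_near. Qed.

Lemma coordwise_jet_cosine_transform : coordwise_jet cosine_transform.
Proof.
split; first by apply: continuous_measurable_rV; exact: continuous_cosine_transform.
move=> xi j.
rewrite (_ : (fun t => _) = fun t =>
  \int[leb]_(x in cube) (p x * cos ((phi - pairing x xi) - t * x ord0 j))).
  apply: cosine_integral_jet => //.
  - exact: measurable_funS measurableT (@subsetT _ _) (@measurable_coord R d j).
  - by apply: measurable_funB => //; exact: measurable_pairing.
  - by move=> x /(_ j)/andP[x0 x1]; rewrite ger0_norm.
apply/funext => t; apply: eq_Rintegral => x _; congr (_ * cos _).
rewrite -addrA -opprD; congr (_ - _); rewrite /pairing.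
under eq_bigr do rewrite !mxE mulrDr eqxx/=.
rewrite big_split/=; congr (_ + _).
rewrite (bigD1 j)//= eqxx mulr1 big1 ?addr0 1?mulrC// => k /negPf kj.
by rewrite kj !mulr0.
Qed.

End fourier_regularity.

Section fourier_transforms.
Context {R : realType} {d : nat}.
Local Notation leb := (lebesgue_rV R d).
Local Notation cube := (@unit_cube R d).
Local Notation C := R[i].
Variable u : 'rV[R]_d -> C.
Hypotheses (Lu : in_L2 leb setT u) (su : supported_in cube u).

Let mcube : measurable cube := measurable_unit_cube.

Let mRe : measurable_fun setT (fun x => complex.Re (u x)). Proof. by case: Lu. Qed.
Let mIm : measurable_fun setT (fun x => complex.Im (u x)). Proof. by case: Lu. Qed.

(** Square-integrable functions are integrable on the cube, which has measure 1,
    as |t| <= 1 + t^2; h is to be the real or the imaginary part. *)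
Lemma integrable_part (h : C -> R) :
  measurable_fun setT (fun x => h (u x)) -> (forall z, h z ^+ 2 <= abs2 z) ->
  leb.-integrable cube (EFin \o (fun x => h (u x))).
Proof.
move=> mh h2.
have i1 : leb.-integrable cube (EFin \o (fun x => 1 + abs2 (u x))).
  apply: (@integrable_RD _ _ _ leb cube mcube (cst 1)).
    apply: measurable_bounded_integrable => //.
      by rewrite [X in (X < _)%E](lebesgue_unit_cube (R := R) (d := d)) ltry.
    exact: bounded_cst.
  exact: (integrableS measurableT mcube (@subsetT _ _) (L2_integrable Lu)).
apply: le_integrable i1 => //.
  by apply/measurable_EFinP; exact: measurable_funS (@subsetT _ _) mh.
move=> x _ /=; rewrite lee_fin [leRHS]ger0_norm ?(addr_ge0 _ (abs2_ge0 _))//.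
have := h2 (u x); have := sqr_ge0 (h (u x) - 1); have := sqr_ge0 (h (u x) + 1).
by rewrite ler_norml !expr2 => *; apply/andP; split; nra.
Qed.

Lemma Rintegral_supported (F : 'rV[R]_d -> R) : measurable_fun setT F ->
  {ae leb, forall x, ~ cube x -> F x = 0} ->
  \int[leb]_x F x = \int[leb]_(x in cube) F x.
Proof.
move=> mF F0; rewrite [RHS]Rintegral_mkcond /Rintegral; congr fine.
apply: ae_eq_integral => //.
- exact/measurable_EFinP.
- apply/measurable_EFinP; apply/(measurable_restrictT _ mcube).
  exact: measurable_funS (@subsetT _ _) mF.
- apply: filterS F0 => x /= Fx _; rewrite patchE.
  by case: ifPn => // /negP xc; rewrite Fx// => cx; apply: xc; rewrite inE.
Qed.

Let ipRe : leb.-integrable cube (EFin \o (fun x => complex.Re (u x))).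
Proof. by apply: integrable_part => // z; rewrite /abs2 lerDl sqr_ge0. Qed.

Let ipIm : leb.-integrable cube (EFin \o (fun x => complex.Im (u x))).
Proof. by apply: integrable_part => // z; rewrite /abs2 lerDr sqr_ge0. Qed.

Let mcospair phi xi : measurable_fun setT
  (fun x : 'rV[R]_d => cos (phi - pairing x xi)).
Proof.
by apply: measurable_cos; apply: measurable_funB => //; exact: measurable_pairing.
Qed.

Let icospair (p : 'rV[R]_d -> R) phi xi : leb.-integrable cube (EFin \o p) ->
  leb.-integrable cube (EFin \o (fun x => p x * cos (phi - pairing x xi))).
Proof.
move=> int_p; apply: integrable_mul_bounded => //; last by move=> x _; exact: cos_max.
exact: measurable_funS (@subsetT _ _) (mcospair phi xi).
Qed.

Lemma expi_pairing (x xi : 'rV[R]_d) :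
  expi (- \sum_(j < d) x ord0 j * xi ord0 j) =
  (cos (0 - pairing x xi) +i* cos (- (pi / 2) - pairing x xi))%C.
Proof.
by rewrite /expi sub0r; congr (_ +i* _)%C; rewrite [in RHS]addrC cosBpihalf.
Qed.

Lemma Re_fourierE xi : complex.Re (fourier u xi) =
  cosine_transform (fun x => complex.Re (u x)) 0 xi +
  (-1) * cosine_transform (fun x => complex.Im (u x)) (- (pi / 2)) xi.
Proof.
rewrite /fourier /= Rintegral_supported; last 2 first.
- under eq_fun do rewrite expi_pairing cReM/=.
  by apply: measurable_funB; apply: measurable_funM => //; exact: mcospair.
- by apply: filterS su => x ux /ux ->; rewrite mul0r.
under eq_Rintegral do rewrite expi_pairing cReM/=.
by rewrite RintegralB ?mulN1r//; exact: icospair.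
Qed.

Lemma Im_fourierE xi : complex.Im (fourier u xi) =
  cosine_transform (fun x => complex.Re (u x)) (- (pi / 2)) xi +
  cosine_transform (fun x => complex.Im (u x)) 0 xi.
Proof.
rewrite /fourier /= Rintegral_supported; last 2 first.
- under eq_fun do rewrite expi_pairing cImM/=.
  by apply: measurable_funD; apply: measurable_funM => //; exact: mcospair.
- by apply: filterS su => x ux /ux ->; rewrite mul0r.
under eq_Rintegral do rewrite expi_pairing cImM/=.
by rewrite RintegralD//; exact: icospair.
Qed.

Lemma coordwise_jet_Re_fourier : coordwise_jet (fun xi => complex.Re (fourier u xi)).
Proof.
under [X in coordwise_jet X]eq_fun do rewrite Re_fourierE.
apply: coordwise_jetD; first exact: coordwise_jet_cosine_transform.
by apply: coordwise_jetZ; exact: coordwise_jet_cosine_transform.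
Qed.

Lemma coordwise_jet_Im_fourier : coordwise_jet (fun xi => complex.Im (fourier u xi)).
Proof.
under [X in coordwise_jet X]eq_fun do rewrite Im_fourierE.
by apply: coordwise_jetD; exact: coordwise_jet_cosine_transform.
Qed.

Lemma continuous_Re_fourier : continuous (fun xi => complex.Re (fourier u xi)).
Proof.
under [X in continuous X]eq_fun do rewrite Re_fourierE mulN1r.
refine (fun xi => @continuousB _ _ _ (cosine_transform _ _)
  (cosine_transform _ _) xi _ _); exact: continuous_cosine_transform.
Qed.

Lemma continuous_Im_fourier : continuous (fun xi => complex.Im (fourier u xi)).
Proof.
under [X in continuous X]eq_fun do rewrite Im_fourierE.
refine (fun xi => @continuousD _ _ _ (cosine_transform _ _)
  (cosine_transform _ _) xi _ _); exact: continuous_cosine_transform.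
Qed.

End fourier_transforms.

(** * Bounds on compact sets *)

Section compactness.
Context {R : realType}.

Lemma continuous_Re_Cplx : continuous (fun z : Cplx R => complex.Re z).
Proof.
move=> z; apply/(@cvgrPdist_lt _ _ _ (nbhs z) (nbhs_filter z)) => e e0.
have e0' : 0 < e%:C%C :> Cplx R by rewrite ltcR.
near=> w.
have : ball z (e%:C%C : Cplx R) w by near: w; exact: nbhsx_ballx.
rewrite -ball_normE /= => zw; rewrite -ltcR; apply: le_lt_trans zw.
rewrite (_ : complex.Re z - complex.Re w = complex.Re ((z : R[i]) - w)).
  exact: normc_ge_Re.
by rewrite cReD; congr (_ + _); case: (w).
Unshelve. all: by end_near. Qed.

Lemma compact_coef_bounded n (K : set 'rV[Cplx R]_n) : compact K ->
  exists M : R, 0 <= M /\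
    forall (c : 'rV[R[i]]_n) i, K c -> abs2 (c ord0 i) <= M.
Proof.
move=> cK.
have bnd (a : R[i]) i : exists M : R, forall c : 'rV[R[i]]_n, K c ->
    `|complex.Re (a * c ord0 i)| <= M.
  pose h (c : 'rV[Cplx R]_n) : R := complex.Re ((a : Cplx R) * c ord0 i).
  have ch : continuous h.
    move=> c; apply: (@continuous_comp _ _ _
      (fun c : 'rV[Cplx R]_n => (a : Cplx R) * c ord0 i)).
      refine (@continuousM _ _ (cst (a : Cplx R))
        (fun c : 'rV[Cplx R]_n => c ord0 i) c _ _).
        exact: cst_continuous.
      exact: coord_continuous.
    exact: continuous_Re_Cplx.
  have /compact_bounded[M [_ HM]] : compact (h @` K).
    by apply: continuous_compact => //; exact: continuous_subspaceT.
  exists (M + 1) => c Kc; apply: (HM (M + 1)); first by rewrite ltrDl.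
  by exists c.
have bnd2 i : exists M : R, 0 <= M /\ forall c : 'rV[R[i]]_n, K c ->
    abs2 (c ord0 i) <= M.
  have [M1 H1] := bnd 1 i; have [M2 H2] := bnd 'i%C i.
  exists (M1 ^+ 2 + M2 ^+ 2); split; first by rewrite addr_ge0 ?sqr_ge0.
  move=> c Kc; have := H1 c Kc; have := H2 c Kc.
  rewrite mul1r; case: (c ord0 i) => x y.
  rewrite /abs2/= mul0r mul1r sub0r normrN => h2 h1.
  rewrite -(@real_normK _ x) ?num_real// -(@real_normK _ y) ?num_real//.
  by rewrite lerD// ler_pXn2r// nnegrE// (le_trans _ h1, le_trans _ h2).
have [M HM] := choice bnd2.
exists (\sum_i M i); split; first by apply: sumr_ge0 => i _; have [] := HM i.
move=> c i Kc; rewrite (bigD1 i)//= ler_wpDr//.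
  by apply: sumr_ge0 => j _; have [] := HM j.
by have [_] := HM i; exact.
Qed.

Lemma compact_continuous_bounded d (A : set 'rV[R]_d) (h : 'rV[R]_d -> R) :
  compact A -> continuous h -> exists M, forall x, A x -> `|h x| <= M.
Proof.
move=> cA ch.
have /compact_bounded[M [_ HM]] : compact (h @` A).
  by apply: continuous_compact => //; exact: continuous_subspaceT.
exists (M + 1) => x Ax; apply: (HM (M + 1)); first by rewrite ltrDl.
by exists x.
Qed.

Lemma compact_positive_lower_bound d (A : set 'rV[R]_d) (h : 'rV[R]_d -> R) :
  compact A -> continuous h -> (forall x, A x -> 0 < h x) ->
  exists2 delta, 0 < delta & forall x, A x -> delta <= h x.
Proof.
move=> cA ch h0.
have [->|/set0P A0] := eqVneq A set0; first by exists 1.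
have cN : {within A, continuous (fun x => - h x)}.
  by apply: continuous_subspaceT => x; exact: (continuousN (ch x)).
have [c /set_mem Ac cmax] := compact_EVT_max A0 cA cN.
exists (h c); first exact: h0.
by move=> x Ax; rewrite -lerN2; apply: cmax; exact/mem_set.
Qed.

End compactness.

(** * Continuity and nonvanishing on the span *)

Section multiplier_problem.
Context {R : realType} {d n : nat}.
Local Notation C := R[i].
Local Notation leb := (lebesgue_rV R d).
Implicit Types (v : 'rV[R]_d -> C).

Definition ccontinuous v : Prop :=
  continuous (fun x => complex.Re (v x)) /\
  continuous (fun x => complex.Im (v x)).

Lemma ccontinuous_cmeasurable v (D : set 'rV[R]_d) : ccontinuous v -> cmeasurable D v.
Proof.
by move=> [c1 c2]; split; apply: measurable_funS (measurableT) (@subsetT _ _) _;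
  exact: continuous_measurable_rV.
Qed.

Lemma continuous_abs2 v : ccontinuous v -> continuous (fun x => abs2 (v x)).
Proof.
move=> [c1 c2]; rewrite /abs2.
under [X in continuous X]eq_fun do rewrite !expr2.
refine (fun x => @continuousD _ _ _
  (fun x => complex.Re (v x) * complex.Re (v x))
  (fun x => complex.Im (v x) * complex.Im (v x)) x _ _).
  exact: (continuousM (c1 x) (c1 x)).
exact: (continuousM (c2 x) (c2 x)).
Qed.

Lemma ccontinuous_lincomb (f : 'I_n -> 'rV[R]_d -> C) c :
  (forall i, ccontinuous (f i)) -> ccontinuous (lincomb f c).
Proof.
move=> cf; rewrite /lincomb /ccontinuous.
elim: (index_enum _) => [|i s [IH1 IH2]].
  by split; under [X in continuous X]eq_fun do rewrite big_nil; exact: cst_continuous.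
have [c1 c2] := cf i.
have cZ (r : R) (h : 'rV[R]_d -> R) : continuous h -> continuous (fun x => r * h x).
  move=> ch; refine (fun x => @continuousM _ _ (cst r) h x _ (ch x)).
  exact: cst_continuous.
split.
  under [X in continuous X]eq_fun do rewrite big_cons cReD cReM.
  refine (fun x => @continuousD _ _ _ (fun x => _) (fun x => _) x _ (IH1 x)).
  exact: (continuousB (cZ _ _ c1 x) (cZ _ _ c2 x)).
under [X in continuous X]eq_fun do rewrite big_cons cImD cImM.
refine (fun x => @continuousD _ _ _ (fun x => _) (fun x => _) x _ (IH2 x)).
exact: (continuousD (cZ _ _ c2 x) (cZ _ _ c1 x)).
Qed.

Lemma ccontinuous_dilate alpha v : ccontinuous v -> ccontinuous (dilate alpha v).
Proof.
have cs : continuous (fun x : 'rV[R]_d => alpha *: x).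
  by move=> x; exact: scaler_continuous.
move=> [c1 c2]; split => x.
  exact: (continuous_comp (cs x) (c1 (alpha *: x))).
exact: (continuous_comp (cs x) (c2 (alpha *: x))).
Qed.

Lemma ccontinuous_bounded v (A : set 'rV[R]_d) : compact A -> ccontinuous v ->
  exists M, forall x, A x -> abs2 (v x) <= M.
Proof.
move=> cA cv.
have [M HM] := compact_continuous_bounded cA (continuous_abs2 cv).
by exists M => x Ax; rewrite (le_trans (ler_norm _))// HM.
Qed.

Lemma coordwise_jet_lincomb (f : 'I_n -> 'rV[R]_d -> C) c :
  (forall i, coordwise_jet (fun x => complex.Re (f i x))) ->
  (forall i, coordwise_jet (fun x => complex.Im (f i x))) ->
  coordwise_jet (fun x => complex.Re (lincomb f c x)) /\
  coordwise_jet (fun x => complex.Im (lincomb f c x)).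
Proof.
move=> jRe jIm; rewrite /lincomb; elim: (index_enum _) => [|i s [IH1 IH2]].
  have j0 : coordwise_jet (fun=> 0 : R) (d := d).
    split=> // x j; exists (fun _ _ => 0), 0; split => //; split => k y.
      exact: is_derive_cst.
    by rewrite normr0.
  by split; under [X in coordwise_jet X]eq_fun do rewrite big_nil.
split.
  under [X in coordwise_jet X]eq_fun do rewrite big_cons cReD cReM -mulNr.
  apply: coordwise_jetD => //.
  by apply: coordwise_jetD; exact: coordwise_jetZ.
under [X in coordwise_jet X]eq_fun do rewrite big_cons cImD cImM.
apply: coordwise_jetD => //.
by apply: coordwise_jetD; exact: coordwise_jetZ.
Qed.

Lemma coordwise_jet_ae_neq0 v x0 :
  coordwise_jet (fun x => complex.Re (v x)) ->
  coordwise_jet (fun x => complex.Im (v x)) ->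
  v x0 != 0 -> {ae leb, forall x, v x != 0}.
Proof.
move=> jRe jIm vx0.
have aux (h : 'rV[R]_d -> R) : coordwise_jet h -> (forall x, v x = 0 -> h x = 0) ->
    h x0 != 0 -> {ae leb, forall x, v x != 0}.
  move=> jh hv hx0; exists [set x | h x = 0]; split.
  - exact: measurable_zeros jh.1.
  - exact: lebesgue_zeros jh hx0.
  - by move=> x /= /negP/negPn/eqP; exact: hv.
have [Re0|Re0] := eqVneq (complex.Re (v x0)) 0; last first.
  by apply: (aux _ jRe) => // x ->.
apply: (aux _ jIm) => [x -> //|]; apply: contra vx0 => /eqP Im0.
by rewrite eq_complex Re0 Im0 !eqxx.
Qed.

Lemma finite_cover_nonzero (A : set 'rV[R]_d) (S : set ('rV[R]_d -> C)) :
  compact A -> (forall v, S v -> ccontinuous v) ->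
  (forall x, A x -> exists2 v, S v & v x != 0) ->
  exists s : seq ('rV[R]_d -> C), (forall v, List.In v s -> S v) /\
    exists2 delta : R, 0 < delta &
      forall x, A x -> delta <= \sum_(v <- s) abs2 (v x).
Proof.
move=> cA cS nzS.
have [A0|/set0P[a Aa]] := eqVneq A set0.
  by exists [::]; split => //; exists 1 => // x; rewrite A0.
have [v0 Sv0 _] := nzS a Aa.
have /choice[V HV] : forall y, exists v, S v /\ (A y -> v y != 0).
  move=> y; have [Ay|nAy] := pselect (A y).
    by have [v Sv vy] := nzS y Ay; exists v.
  by exists v0.
pose O y := [set x | 0 < abs2 (V y x)].
have oO y : A y -> open (O y).
  move=> _; rewrite (_ : O y = (fun x => abs2 (V y x)) @^-1` [set r | 0 < r])//.
  apply: open_comp; last exact: open_gt.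
  by move=> x _; exact: (continuous_abs2 (cS _ (HV y).1)).
have abs2_gt0 (z : C) : z != 0 -> 0 < abs2 z.
  by move=> z0; rewrite lt_neqAle abs2_ge0 andbT eq_sym;
    apply: contra z0 => /eqP/abs2_eq0 ->.
have AO : A `<=` cover A O.
  by move=> x Ax; exists x => //; apply: abs2_gt0; exact: (HV x).2.
have := cA; rewrite compact_cover => /(_ _ A O oO AO)[D' D'A AD'].
pose s := [seq V y | y <- finmap.enum_fset D'].
have sS v : List.In v s -> S v.
  by rewrite /s; elim: (finmap.enum_fset D') => //= y r IH [<-|/IH//]; exact: (HV y).1.
exists s; split => //.
apply: compact_positive_lower_bound => //.
  elim: (s) sS => [|v r IH] rS.
    by under [X in continuous X]eq_fun do rewrite big_nil; exact: cst_continuous.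
  under [X in continuous X]eq_fun do rewrite big_cons.
  refine (fun x => @continuousD _ _ _ (fun x => abs2 (v x)) (fun x => _) x _ _).
    by apply: continuous_abs2; apply: cS; apply: rS; left.
  by apply: IH => w rw; apply: rS; right.
move=> x Ax; have [y /= yD' Oy] := AD' x Ax.
have {yD'} : y \in finmap.enum_fset D' by [].
rewrite /s; elim: (finmap.enum_fset D') => // z r IH.
rewrite inE /= big_cons => /orP[/eqP <-|/IH r0].
  by rewrite ltr_pwDl// big_map sumr_ge0// => w _; exact: abs2_ge0.
by rewrite ltr_wpDl// abs2_ge0.
Qed.

End multiplier_problem.

(** * Worst-case optimal multipliers *)

Section optimal_multipliers.
Context {R : realType} {d n : nat}.
Local Notation C := R[i].
Local Notation leb := (lebesgue_rV R d).
Variables (f : 'I_n -> 'rV[R]_d -> C) (Omega0 : set 'rV[R]_d) (alpha : R).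
Variables (mu : {measure set 'rV[R]_d -> \bar R}) (S : set ('rV[R]_d -> C)).
Hypotheses (cf : forall i, ccontinuous (f i)) (cO : compact Omega0).
Hypothesis muf : L2_norm_equivalent mu (span_of f).
Hypothesis f_pos : forall xi, Omega0 xi -> 0 < \sum_(i < n) abs2 (f i xi).
Hypothesis Sspan : S `<=` span_of f.

Local Notation Df := (fun i => dilate alpha (f i)).

Lemma measurable_Omega0 : measurable Omega0.
Proof.
rewrite -(setCK Omega0); apply: measurableC; apply: open_measurable_rV.
apply: closed_openC; apply: compact_closed cO.
exact: norm_hausdorff.
Qed.
Let mO := measurable_Omega0.

Lemma lincomb_delta i : lincomb f (delta_mx ord0 i) = f i.
Proof.
apply/funext => x; rewrite /lincomb (bigD1 i)//= mxE !eqxx mul1r big1 ?addr0//.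
by move=> j /negPf ji; rewrite mxE eqxx ji mul0r.
Qed.

Lemma L2_basis i : in_L2 mu Omega0 (f i).
Proof.
have LT : in_L2 mu setT (f i).
  have [m1 m2] := ccontinuous_cmeasurable setT (cf i).
  split => //; have [c [K [_ _ H]]] := muf.
  have /H/andP[_] : span_of f (f i).
    by exists (delta_mx ord0 i) => //; exact: lincomb_delta.
  by move/le_lt_trans; apply; exact: ltry.
have [m1 m2] := ccontinuous_cmeasurable Omega0 (cf i).
split => //; case: LT => _ _; apply: le_lt_trans.
apply: ge0_subset_integral => //.
- apply/measurable_EFinP; apply: measurable_abs2.
  exact: ccontinuous_cmeasurable.
- by move=> x _; rewrite lee_fin abs2_ge0.
Qed.

(** On Omega0 the sum of the |f_i|^2, which is mu-integrable, is bounded below by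
    a positive constant, so a bounded function is dominated by a multiple of
    it. *)
Lemma L2_ccontinuous v : ccontinuous v -> in_L2 mu Omega0 v.
Proof.
move=> cv; have [K HK] := ccontinuous_bounded cO cv.
have csum : continuous (fun x => \sum_(i < n) abs2 (f i x)).
  elim: (index_enum _) => [|i s IH].
    by under [X in continuous X]eq_fun do rewrite big_nil; exact: cst_continuous.
  under [X in continuous X]eq_fun do rewrite big_cons.
  refine (fun x => @continuousD _ _ _ (fun x => abs2 (f i x)) (fun x => _) x _ (IH x)).
  exact: (continuous_abs2 (cf i)).
have [delta delta0 Hdelta] := compact_positive_lower_bound cO csum f_pos.
apply: (@L2_dominated _ _ _ mu Omega0 mO _
  (fun x => K / delta * \sum_(i < n) abs2 (f i x))).
- exact: ccontinuous_cmeasurable.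
- apply: integrable_RZ => //; apply: integrable_Rsum => // i.
  exact: L2_integrable (L2_basis i).
- move=> x Ox; have K0 : 0 <= K by apply: le_trans (HK x Ox); exact: abs2_ge0.
  apply: (le_trans (HK x Ox)); rewrite mulrAC ler_pdivlMr// ler_wpM2l//.
  exact: Hdelta.
Qed.

Lemma S_ccontinuous v : S v -> ccontinuous v.
Proof. by move=> /Sspan[c _ <-]; exact: ccontinuous_lincomb. Qed.

Let La v : S v -> in_L2 mu Omega0 (dilate alpha v).
Proof.
by move=> Sv; apply: L2_ccontinuous; apply: ccontinuous_dilate; exact: S_ccontinuous.
Qed.

Let mb v : S v -> cmeasurable Omega0 v.
Proof. by move=> Sv; apply: ccontinuous_cmeasurable; exact: S_ccontinuous. Qed.

Let bb v : S v -> exists K : R, forall x, Omega0 x -> abs2 (v x) <= K.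
Proof. by move=> Sv; apply: ccontinuous_bounded => //; exact: S_ccontinuous. Qed.

Lemma mult_errorE v m : S v -> in_L2 mu Omega0 m ->
  mult_error mu Omega0 alpha v m =
  (2^-1 * sqnorm mu Omega0 (fun x => dilate alpha v x - m x * v x))%:E.
Proof.
move=> Sv Lm; rewrite /mult_error sqnormE//.
exact: (L2_residual mO La mb bb Sv Lm).
Qed.

Local Notation level := (sublevel mu Omega0 S (dilate alpha) id).

Lemma worst_case_le m t : in_L2 mu Omega0 m ->
  (worst_case_error mu Omega0 alpha S m <= t%:E)%E <-> level t m.
Proof.
move=> Lm; split => [mt|[_ mt]].
  split => // v Sv; rewrite -lee_fin -mult_errorE//; apply: le_trans mt.
  by apply: ereal_sup_ubound; exists v.
apply: ge_ereal_sup => _ [v Sv <-].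
by rewrite mult_errorE// lee_fin; exact: mt.
Qed.

Lemma worst_case_ge0 m : S !=set0 ->
  (0 <= worst_case_error mu Omega0 alpha S m)%E.
Proof.
move=> [v Sv]; apply: (@le_trans _ _ (mult_error mu Omega0 alpha v m)).
  rewrite /mult_error mule_ge0// integral_ge0// => x _.
  by rewrite lee_fin abs2_ge0.
by apply: ereal_sup_ubound; exists v.
Qed.

Lemma optimal_multiplier_exists : Omega0 !=set0 ->
  (forall xi, Omega0 xi -> exists2 v, S v & v xi != 0) ->
  exists m, worst_case_optimal mu Omega0 alpha S m.
Proof.
move=> [x0 Ox0] nzS.
have S0 : S !=set0 by have [v Sv _] := nzS x0 Ox0; exists v.
(* if no multiplier has a finite worst-case error, all of them are optimal *)
have [tm|no_level] := pselect (exists t m, level t m); last first.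
  exists (cst 0); split; first exact: L20.
  move=> m' Lm'; rewrite [leRHS](_ : _ = +oo%E) ?leey//.
  apply/eqP; rewrite -leye_eq leNgt; apply/negP => m'oo.
  apply: no_level; exists (fine (worst_case_error mu Omega0 alpha S m')), m'.
  apply/(worst_case_le _ Lm').
  by rewrite fineK// ge0_fin_numE// worst_case_ge0.
have [s [sS [delta delta0 Hdelta]]] := finite_cover_nonzero cO S_ccontinuous nzS.
have [i0 [m0 [m0i0 i0min]]] :=
  sublevel_min mO S0 La mb bb sS delta0 Hdelta tm.
exists m0; split; first by case: m0i0.
move=> m' Lm'; have Lm0 : in_L2 mu Omega0 m0 by case: m0i0.
apply: (@le_trans _ _ i0%:E); first exact/worst_case_le.
have := worst_case_ge0 m' S0.
case E : (worst_case_error mu Omega0 alpha S m') => [t| |]// _; last exact: leey.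
rewrite lee_fin; apply: (i0min t m').
by apply/(worst_case_le _ Lm'); rewrite E.
Qed.

Hypothesis Scompact : compact [set c : 'rV[Cplx R]_n | S (lincomb f c)].
Hypothesis jRe : forall i, coordwise_jet (fun x => complex.Re (f i x)).
Hypothesis jIm : forall i, coordwise_jet (fun x => complex.Im (f i x)).

Local Notation K := ([set c : 'rV[C]_n | S (lincomb f c)]).

Lemma lincomb_ae_neq0 c x0 : lincomb f c x0 != 0 ->
  {ae leb, forall x, lincomb f c x != 0}.
Proof.
have [j1 j2] := coordwise_jet_lincomb c jRe jIm.
exact: coordwise_jet_ae_neq0.
Qed.

Lemma sqnorm_comb_bounded (w : 'I_n -> 'rV[R]_d -> C) (M : R) :
  (forall i, in_L2 mu Omega0 (w i)) ->
  exists B, forall c : 'rV[C]_n, (forall i, abs2 (c ord0 i) <= M) ->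
    sqnorm mu Omega0 (comb c w) <= B.
Proof.
move=> Lw; rewrite /comb; elim: (index_enum _) => [|i s [B HB]].
  exists 0 => c _; under [X in sqnorm _ _ X]eq_fun do rewrite big_nil.
  by rewrite -innerxx inner0l.
exists (2 * (M * sqnorm mu Omega0 (w i)) + 2 * B) => c cM.
under [X in sqnorm _ _ X]eq_fun do rewrite big_cons.
have Lcw : in_L2 mu Omega0 (fun x => c ord0 i * w i x) by exact: L2Z.
have Ls : in_L2 mu Omega0 (fun x => \sum_(j <- s) c ord0 j * w j x).
  by apply: L2_sum => // j; exact: L2Z.
have := @sqnorm_midpoint _ _ _ mu Omega0 mO _ _ Lcw Ls.
have L1 : in_L2 mu Omega0 (fun x => c ord0 i * w i x +
  \sum_(j <- s) c ord0 j * w j x) by exact: L2D.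
rewrite sqnormZ// (_ : 4 * (2^-1 ^+ 2 * _) = sqnorm mu Omega0 (fun x =>
  c ord0 i * w i x + \sum_(j <- s) c ord0 j * w j x)); last first.
  by rewrite expr2; field.
have := HB c cM.
have : sqnorm mu Omega0 (fun x => c ord0 i * w i x) <= M * sqnorm mu Omega0 (w i).
  by apply: le_sqnorm => // x _; rewrite abs2M ler_wpM2r ?abs2_ge0.
have : 0 <= sqnorm mu Omega0 (fun x => \sum_(j <- s) c ord0 j * w j x -
    c ord0 i * w i x) by exact: sqnorm_ge0.
set a := sqnorm _ _ _; set b := sqnorm _ _ _; set e := sqnorm _ _ _.
set g := sqnorm _ _ _; set h := sqnorm _ _ _.
lra.
Qed.

(** The matrix of [stationary_matrix] could a priori have an identically vanishing
    form, but then it would vanish on all values of f, hence on those of w, and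
    the worst-case error would be 0; this case is treated apart. *)
Lemma optimal_multiplier_quotient m : (exists2 v, S v & v <> cst 0) ->
  worst_case_optimal mu Omega0 alpha S m ->
  exists Sigma : 'M[C]_n,
     [/\ psd_hermitian Sigma,
         {ae leb, forall xi, Omega0 xi ->
           cdot (vec f xi) (Sigma *m vec f xi) != 0} &
         {ae mu, forall xi, Omega0 xi ->
           cdot (vec f xi) (Sigma *m vec f xi) != 0 ->
           m xi = cdot (vec f xi) (Sigma *m vec Df xi)
                  / cdot (vec f xi) (Sigma *m vec f xi)}].
Proof.
move=> [v Sv v0] [Lm mopt].
have [M [M0 HM]] := compact_coef_bounded Scompact.
have LDf i : in_L2 mu Omega0 (Df i).
  by apply: L2_ccontinuous; exact: ccontinuous_dilate.
have [F HF] : exists F : R, 0 <= F /\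
    forall i x, Omega0 x -> abs2 (f i x) <= F.
  have /choice[F HF] : forall i, exists F : R, 0 <= F /\
      forall x, Omega0 x -> abs2 (f i x) <= F.
    move=> i; have [F HF] := ccontinuous_bounded cO (cf i).
    exists `|F|; split => // x Ox.
    exact: le_trans (HF x Ox) (ler_norm _).
  exists (\sum_i F i); split; first by apply: sumr_ge0 => i _; have [] := HF i.
  move=> i x Ox; rewrite (bigD1 i)//= ler_wpDr//.
    by apply: sumr_ge0 => j _; have [] := HF j.
  by have [_] := HF i; exact.
pose w i x := Df i x - m x * f i x.
have Lw i : in_L2 mu Omega0 (w i).
  apply: L2B => //.
  under [X in in_L2 _ _ X]eq_fun do rewrite mulrC.
  apply: (@L2_bounded_mul _ _ _ _ _ mO _ _ F) => //.
    exact: ccontinuous_cmeasurable.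
  exact: HF.2.
have combw (c : 'rV[C]_n) (m' : 'rV[R]_d -> C) x :
    dilate alpha (lincomb f c) x - m' x * lincomb f c x =
    comb c Df x - m' x * comb c f x by [].
have combwE (c : 'rV[C]_n) x : comb c w x = comb c Df x - m x * comb c f x.
  rewrite /comb mulr_sumr -sumrB; apply: eq_bigr => i _.
  by rewrite /w; ring.
have S0 : S !=set0 by exists v.
have [B HB] := sqnorm_comb_bounded M Lw.
have mB : level (2^-1 * B) m.
  split => // v' Sv'; have [c _ cE] := Sspan Sv'.
  rewrite ler_pM2l// -cE.
  rewrite (_ : (fun x => _) = comb c w); last first.
    by apply/funext => x; rewrite combwE.
  by apply: HB => i; apply: HM; rewrite /= cE.
set Ew := worst_case_error mu Omega0 alpha S m in mopt.
have Ew_fin : Ew \is a fin_num.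
  rewrite ge0_fin_numE ?worst_case_ge0//.
  by apply: le_lt_trans (ltry (2^-1 * B)); exact/worst_case_le.
pose Es := fine Ew.
have [_ mEs] : level Es m by apply/worst_case_le => //; rewrite fineK.
have [c Kc cE] : exists2 c, K c & lincomb f c = v.
  by have [c _ cE] := Sspan Sv; exists c => //=; rewrite cE.
have wEs c' : K c' -> 2^-1 * sqnorm mu Omega0 (comb c' w) <= Es.
  move=> Kc'; rewrite (_ : comb c' w = fun x =>
    dilate alpha (lincomb f c') x - m x * lincomb f c' x).
    exact: mEs.
  by apply/funext => x; rewrite combwE.
have [Sigma [psdS SE Sae]] : exists Sigma : 'M[C]_n, [/\ psd_hermitian Sigma,
    2^-1 * \int[mu]_(x in Omega0)
      complex.Re (cdot (cvec w x) (Sigma *m cvec w x)) = Es &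
    {ae mu, forall x, Omega0 x -> cdot (cvec f x) (Sigma *m cvec w x) = 0}].
  apply: (stationary_matrix mO (K := K) (F := F) (M := M) _ HF.2 LDf Lm HF.1) => //.
  - by move=> i; exact: ccontinuous_cmeasurable.
  - by exists c.
  - move=> m' t Lm' m't; rewrite -lee_fin fineK//.
    apply: (le_trans (mopt m' Lm')); apply/worst_case_le => //; split => // v' Sv'.
    have [c' _ c'E] := Sspan Sv'; rewrite -c'E; apply: m't.
    by rewrite /= c'E.
have [Es0|Es0] := eqVneq Es 0.
  (* the error vanishes on S: a single element of S already determines m *)
  have [x0 vx0] : exists x0, v x0 != 0.
    apply/not_existsP => H; apply: v0; apply/funext => x.
    by have /negP/negPn/eqP := H x.
  exists (rank1 c); split; first exact: rank1_psd.
  - have := @lincomb_ae_neq0 c x0; rewrite cE => /(_ vx0).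
    apply: filterS => x vx _; rewrite (cdot_rank1 c f f x).
    rewrite (_ : comb c f x = v x); last by rewrite -cE.
    by rewrite mulf_neq0// conjC_eq0.
  - have Lcw : in_L2 mu Omega0 (comb c w) by apply: L2_sum => // i; exact: L2Z.
    have cw0 : sqnorm mu Omega0 (comb c w) = 0.
      apply/eqP; rewrite eq_le sqnorm_ge0 andbT -(@pmulr_rle0 _ 2^-1)//.
      by rewrite -Es0; exact: wEs.
    apply: filterS (sqnorm_eq0 mO Lcw cw0) => x /= H Ox.
    rewrite (cdot_rank1 c f f x) (cdot_rank1 c f Df x) => nz.
    have /eqP := H Ox; rewrite combwE subr_eq0 => /eqP ->.
    move: nz; rewrite mulf_eq0 negb_or => /andP[n1 n2].
    by rewrite mulrCA mulfK// mulf_neq0.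
exists Sigma; split => //.
- (* Sigma f = 0 everywhere would give Sigma w = 0, as D_alpha f takes values
     of f, and then Es = 0 *)
  have [xi0 [k nz]] : exists xi0 k, (Sigma *m cvec f xi0) k ord0 != 0.
    apply/not_existsP => H; move/eqP: Es0; apply.
    have Sf0 xi : Sigma *m cvec f xi = 0.
      apply/colP => k; rewrite [RHS]mxE; apply/eqP/negPn/negP => nz.
      by apply: (H xi); exists k.
    rewrite -SE (@eq_Rintegral _ _ _ mu _ (cst 0)).
      by rewrite Rintegral_cst// mul0r mulr0.
    move=> x _; rewrite (_ : cvec w x = cvec f (alpha *: x) - m x *: cvec f x).
      rewrite mulmxBr -scalemxAr !Sf0 scaler0 subr0.
      by rewrite /cdot big1// => k _; rewrite [X in _ * X]mxE mulr0.
    by apply/colP => k; rewrite !mxE.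
  have rowE xi : (Sigma *m cvec f xi) k ord0 = lincomb f (row k Sigma) xi.
    by rewrite mxE; apply: eq_bigr => l _; rewrite !mxE.
  rewrite rowE in nz; apply: filterS (lincomb_ae_neq0 nz) => xi H _.
  apply: contra H => /eqP form0; rewrite -rowE.
  by rewrite (psd_form_eq0 psdS form0) mxE.
- apply: filterS Sae => x /= H Ox nz.
  have := H Ox; rewrite (_ : cvec w x = vec Df x - m x *: vec f x); last first.
    by apply/colP => k; rewrite !mxE.
  rewrite mulmxBr -scalemxAr -scaleN1r cdotDr !cdotZr mulN1r.
  by move/eqP; rewrite subr_eq0 => /eqP ->; rewrite mulfK.
Qed.

End optimal_multipliers.

Theorem corollary4p1 (R : realType) (d n : nat)
  (u : 'I_n -> 'rV[R]_d -> R[i])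
  (Omega0 : set 'rV[R]_d) (alpha : R)
  (mu : {measure set 'rV[R]_d -> \bar R})
  (S : set ('rV[R]_d -> R[i])) :
  let f := fun i : 'I_n => fourier (u i) in
  let Df := fun i : 'I_n => dilate alpha (f i) in
  (0 < d)%N ->
  (forall i, in_L2 (lebesgue_rV R d) setT (u i)) ->
  L2_independent u ->
  (forall i, supported_in (@unit_cube R d) (u i)) ->
  compact Omega0 -> Omega0° !=set0 ->
  1 < alpha ->
  L2_norm_equivalent mu (span_of f) ->
  compact_in_span f S ->
  (forall xi, Omega0 xi -> 0 < \sum_(i < n) abs2 (f i xi)) ->
  ((forall xi, Omega0 xi -> exists2 v, S v & v xi != 0) ->
   exists m, worst_case_optimal mu Omega0 alpha S m) /\
  ((exists2 v, S v & v <> cst 0) ->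
   forall m, worst_case_optimal mu Omega0 alpha S m ->
   exists Sigma : 'M[R[i]]_n,
     [/\ psd_hermitian Sigma,
         {ae lebesgue_rV R d, forall xi, Omega0 xi ->
           cdot (vec f xi) (Sigma *m vec f xi) != 0} &
         {ae mu, forall xi, Omega0 xi ->
           cdot (vec f xi) (Sigma *m vec f xi) != 0 ->
           m xi = cdot (vec f xi) (Sigma *m vec Df xi)
                  / cdot (vec f xi) (Sigma *m vec f xi)}]).
Proof.
move=> f Df _ Lu _ su cO O0 _ muf [Sspan Scompact] f_pos.
have cf i : ccontinuous (f i).
  split; first exact: (continuous_Re_fourier (Lu i) (su i)).
  exact: (continuous_Im_fourier (Lu i) (su i)).
have On0 : Omega0 !=set0 by have [x /interior_subset Ox] := O0; exists x.
split=> [nzS|nzS m opt].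
  exact: optimal_multiplier_exists cf cO muf f_pos Sspan On0 nzS.
apply: (optimal_multiplier_quotient cf cO muf f_pos Sspan Scompact _ _ nzS opt).
  by move=> i; exact: (coordwise_jet_Re_fourier (Lu i) (su i)).
by move=> i; exact: (coordwise_jet_Im_fourier (Lu i) (su i)).
Qed.
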